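(* Let $(\chi_t)_{t\in K}$ be a one-parameter family of characters $\chi_t:\mathfrak{U}\to K$. Assume that there is a countably infinite subset $\{s_1,s_2,\ldots\}\subseteq K$ such that $\chi_{s_i}$ is a good character for every $i$. Assume moreover that for every $(p,q)\in\mathbb{N}^2$ there is a number $n(p,q)$ such that $\dim(Con^{p,q}/\operatorname{rad}(\operatorname{pair}^{p,q}_{\chi_{s_i}}))\leq n(p,q)$ for every $i$. Then there are at most countably many values of $t\in K$ for which $\chi_t$ is not a good character. If in addition $(\chi_t)$ is additive then $\chi_t$ is a good character for all $t\in K$, and if it is multiplicative then $\chi_t$ is a good character for all $t\neq 0$.
   Context: $K$ is an algebraically closed field of characteristic zero, $\mathbb{N}=\{0,1,2,\dots\}$, and a type $((p_i,q_i))_{i=1}^r\in(\mathbb{N}^2)^r$ is fixed. Diagrams. A diagram with $q$ inputs and $p$ outputs consists of a finite set of boxes, each labelled by one of the symbols $x_1,\dots,x_r$, where a box labelled $x_i$ has $q_i$ ordered input slots and $p_i$ ordered output slots; a bijection (the strings) from the disjoint union of $\{$global inputs $1,\dots,q\}$ and the output slots of all boxes onto the disjoint union of $\{$global outputs $1,\dots,p\}$ and the input slots of all boxes; and a finite number of closed loops. Diagrams are equivalent if isomorphic. $Con^{p,q}$ is the $K$-vector space with basis the equivalence classes, thought of as formal morphisms $W^{\otimes q}\to W^{\otimes p}$; composition is gluing, tensor product is juxtaposition. A closed diagram is one with $p=q=0$. $\mathfrak{U}:=Con^{0,0}$ is a commutative algebra under juxtaposition, and is the polynomial algebra on the set $P$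 of (equivalence classes of) closed connected diagrams (nonempty; the single loop included). A character is a $K$-algebra homomorphism $\mathfrak{U}\to K$; characters are identified by restriction with functions $P\to K$, and are added and multiplied pointwise on $P$. Closing up strings gives $\operatorname{Tr}:Con^{p,p}\to\mathfrak{U}$; $\operatorname{pair}^{p,q}(T_1\otimes T_2)=\operatorname{Tr}(T_1\circ T_2)$ defines $Con^{p,q}\otimes Con^{q,p}\to\mathfrak{U}$. For a character $\chi$, $\operatorname{pair}^{p,q}_\chi=\chi\circ\operatorname{pair}^{p,q}$ and $\operatorname{rad}(\operatorname{pair}_\chi^{p,q})=\{f\in Con^{p,q}:\operatorname{pair}_\chi^{p,q}(f\otimes g)=0\ \forall g\in Con^{q,p}\}$. $\mathcal{C}_0$ has objects $W^{a,b}$ ($a,b\in\mathbb{N}$), thought of as $W^{\otimes a}\otimes(W^* )^{\otimes b}$, and $\operatorname{Hom}_{\mathcal{C}_0}(W^{a,b},W^{c,d})=Con^{c+b,d+a}$ (interpreted through duality); composition, tensor product $W^{a,b}\otimes W^{c,d}=W^{a+c,b+d}$, symmetry and duality $(W^{a,b})^*=W^{b,a}$ are given by the corresponding gluing of strings. $\mathcal{C}_{univ}$ is its additive envelope; it is rigid symmetric monoidal with $\operatorname{End}(\mathbf{1})=\mathfrak{U}$, so categorical traces lie in $\mathfrak{U}$. Put $\mathcal{N}_\chi(W^{a,b},W^{c,d})=\operatorname{rad}(\operatorname{pair}_\chi^{c+b,d+a})$, extended componentwise to direct sums; morphisms in $\mathcal{N}_\chi$ are called $\chi$-negligible. A character $\chi$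 is good if (1) for all $p,q\in\mathbb{N}$ the subspace $\operatorname{rad}(\operatorname{pair}_\chi^{p,q})\subseteq Con^{p,q}$ has finite codimension, and (2) if $B\in\mathcal{C}_{univ}$ and $T:B\to B$ is such that $T^m$ is $\chi$-negligible for some $m>0$, then $\chi(\operatorname{Tr}(T))=0$. A one-parameter family of characters is a collection $(\chi_t)_{t\in K}$ of characters such that for every closed diagram $Di$ the element $\chi_t(Di)\in K$ is a polynomial in $t$. It is additive if $\chi_{t_1}+\chi_{t_2}=\chi_{t_1+t_2}$ for all $t_1,t_2\in K$, and multiplicative if $\chi_{t_1}\chi_{t_2}=\chi_{t_1t_2}$ for all $t_1,t_2\in K$. *)

(* Defs.v *)
From HB Require Import structures.
From mathcomp Require Import all_boot all_order all_algebra.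
From mathcomp Require Import boolp.
From mathcomp Require Import finmap.
From mathcomp Require Import monalg.

Set Implicit Arguments.
Unset Strict Implicit.
Unset Printing Implicit Defensive.

Import GRing.Theory.
Local Open Scope ring_scope.
Local Open Scope quotient_scope.

(** * Bijections between finite sums *)

Definition sum_swap (A B : Type) (x : A + B) : B + A :=
  match x with inl a => inr a | inr b => inl b end.

Definition sum_map (A A' B B' : Type) (f : A -> A') (g : B -> B')
    (x : A + B) : A' + B' :=
  match x with inl a => inl (f a) | inr b => inr (g b) end.

(* (A + B) + (C + D) -> (A + D) + (C + B) *)
Definition sum_cross (A B C D : Type) (x : (A + B) + (C + D)) :
    (A + D) + (C + B) :=
  match x with
  | inl (inl a) => inl (inl a)
  | inl (inr b) => inr (inr b)
  | inr (inl c) => inr (inl c)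
  | inr (inr d) => inl (inr d)
  end.

(* (A + B) + C -> (A + C) + B *)
Definition sum_right (A B C : Type) (x : (A + B) + C) : (A + C) + B :=
  match x with
  | inl (inl a) => inl (inl a)
  | inl (inr b) => inr b
  | inr c => inl (inr c)
  end.

Definition sum_ord0 (A : Type) (x : 'I_0 + A) : A :=
  match x with
  | inl i => match notF (ltn_ord i) with end
  | inr a => a
  end.

Lemma id_bij (A : Type) : bijective (@id A).
Proof. by exists id. Qed.

Lemma sum_swap_bij A B : bijective (@sum_swap A B).
Proof. by exists (@sum_swap B A); case. Qed.

Lemma sum_map_bij A A' B B' (f : A -> A') (g : B -> B') :
  bijective f -> bijective g -> bijective (sum_map f g).
Proof.
case=> f' fK f'K [g' gK g'K]; exists (sum_map f' g') => -[x|x] /=;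
by rewrite ?fK ?f'K ?gK ?g'K.
Qed.

Lemma sum_cross_bij A B C D : bijective (@sum_cross A B C D).
Proof. by exists (@sum_cross A D C B); case=> -[]. Qed.

Lemma sum_right_bij A B C : bijective (@sum_right A B C).
Proof. by exists (@sum_right A C B); [case=> [[]|] | case=> [[]|]]. Qed.

Lemma sum_ord0_bij A : bijective (@sum_ord0 A).
Proof. by exists inr => [[[]|]|]. Qed.

Lemma inr_ord0_bij A : bijective (@inr 'I_0 A).
Proof. by exists (@sum_ord0 A) => [|[[]|]]. Qed.

Lemma split_bij m n : bijective (@split m n).
Proof. by exists (@unsplit m n); [exact: splitK | exact: unsplitK]. Qed.

Lemma unsplit_bij m n : bijective (@unsplit m n).
Proof. by exists (@split m n); [exact: unsplitK | exact: splitK]. Qed.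

(** * Closing up part of a bijection

   For a bijection [f : A + S -> C + S], every element of the second copy of
   [S] is identified with the same element of the first one.  Following
   [f] from [a : A] until [C] is reached gives a bijection [feedback f : A ->
   C]; the elements of [S] which are never left lie on closed cycles, and
   [feedback_loops f] is the number of these cycles. *)

Section Feedback.
Variables (A C S : finType) (f : A + S -> C + S).

Fixpoint feedback_run (n : nat) (x : C + S) : option C :=
  match x, n with
  | inl c, _ => Some c
  | inr s, n'.+1 => feedback_run n' (f (inr s))
  | inr _, 0 => None
  end.

Definition feedback_next : rel S := fun s t => f (inr s) == inr t.

Definition feedback_loops : nat :=
  #|[set [set t | connect feedback_next s t] | s : S
      & [exists t, feedback_next s t && connect feedback_next t s]]%SET|.

Hypothesis f_bij : bijective f.

Lemma feedback_total a :
  exists c, feedback_run #|S| (f (inl a)) == Some c.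
Proof.
case: f_bij => g fK _; pose f_inj := can_inj fK.
suff run n (V : {set S}) (z : A + S) :
    (#|~: V| <= n)%N ->
    z = inl a \/ (exists2 v, v \in V & z = inr v) ->
    (forall v, v \in V -> exists y,
       [/\ y = inl a \/ (exists2 w, w \in V & y = inr w), y <> z
         & f y = inr v]) ->
    exists c, feedback_run n (f z) == Some c.
  apply: (run _ set0%SET); [exact: max_card | by left |].
  by move=> v; rewrite inE.
elim: n V z => [|n IHn] V z leVn zV Vz; case fz: (f z) => [c|s] /=;
  try by exists c.
- have sV : s \in V.
    by move: leVn; rewrite leqn0 cards_eq0 => /eqP/setP/(_ s); rewrite !inE
      => /negbFE.
  by have [y [_ yz]] := Vz s sV; rewrite -fz => /f_inj.
- have sNV : s \notin V.
    by apply/negP=> /Vz[y [_ yz]]; rewrite -fz => /f_inj.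
  apply: (IHn (s |: V)%SET).
  + rewrite -ltnS; apply: leq_trans leVn; apply: proper_card.
    apply/properP; split; first by apply/subsetP=> x; rewrite !inE => /norP[].
    by exists s; rewrite !inE ?eqxx.
  + by right; exists s; rewrite ?inE ?eqxx.
  + move=> v; rewrite !inE => /orP[/eqP->|vV].
      exists z; split=> //.
        case: zV => [->|[w wV ->]]; first by left.
        by right; exists w; rewrite ?inE ?wV ?orbT.
      by case: zV => [->|[w wV ->]] // [ws]; rewrite -ws wV in sNV.
    have [y [yV yz fy]] := Vz v vV; exists y; split=> //.
      case: yV => [->|[w wV ->]]; first by left.
      by right; exists w; rewrite ?inE ?wV ?orbT.
    by case: yV => [->|[w wV ->]] // [ws]; rewrite -ws wV in sNV.
Qed.

Definition feedback (a : A) : C := xchoose (feedback_total a).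

Lemma feedbackP a : feedback_run #|S| (f (inl a)) = Some (feedback a).
Proof. exact/eqP/(xchooseP (feedback_total a)). Qed.

Lemma feedback_bij : bijective feedback.
Proof.
have [g fK gK] := f_bij.
pose back (z : A + S) := if z is inr s then Some (g (inr s)) else None.
have run_back n z c : feedback_run n (f z) = Some c ->
    exists k, iter k (obind back) (Some (g (inl c))) = Some z.
  elim: n z => [|n IHn] z; case fz: (f z) => [d|s] //=.
  - by case=> <-; exists 0; rewrite /= -fz fK.
  - by case=> <-; exists 0; rewrite /= -fz fK.
  - by case/IHn=> k Hk; exists k.+1; rewrite iterS Hk /= -fz fK.
apply: inj_card_bij => [a a' aa'|].
  have [k Hk] := run_back _ _ _ (feedbackP a).
  have [k' Hk'] := run_back _ _ _ (feedbackP a').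
  rewrite -aa' in Hk'.
  move: (feedback a) {aa'} Hk Hk' => c Hk Hk'.
  wlog le_kk' : a a' k k' Hk Hk' / (k <= k')%N.
    move=> W; case/orP: (leq_total k k') => le; first exact: (W a a' k k').
    exact/esym/(W a' a k' k).
  move: Hk'; rewrite -(subnK le_kk') iterD Hk.
  case: (k' - k)%N => [|d]; first by case.
  suff -> : iter d.+1 (obind back) (Some (inl a)) = None by [].
  by rewrite iterSr /=; elim: d => [|d /= ->].
have := bij_eq_card f_bij; rewrite !card_sum => /eqP.
by rewrite eqn_add2r => /eqP ->.
Qed.

End Feedback.

Lemma feedback_map (A C A' C' S : finType) (f : A + S -> C + S)
    (f' : A' + S -> C' + S) (hA : A -> A') (hC : C -> C')
    (fb : bijective f) (fb' : bijective f') :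
  (forall u, f' (sum_map hA id u) = sum_map hC id (f u)) ->
  (forall a, feedback fb' (hA a) = hC (feedback fb a)) /\
  feedback_loops f' = feedback_loops f.
Proof.
move=> H; split.
  have R n x : feedback_run f' n (sum_map hC id x) =
               omap hC (feedback_run f n x).
    by elim: n x => [|n IH] [c|s] //=; rewrite -IH -H.
  move=> a; have := feedbackP fb' (hA a).
  by rewrite -[inl (hA a)]/(sum_map hA id (inl a)) H R feedbackP; case.
have E s t : feedback_next f' s t = feedback_next f s t.
  rewrite /feedback_next -[inr s]/(sum_map hA id (inr s)) H.
  by case: (f (inr s)).
have EC : connect (feedback_next f') =2 connect (feedback_next f).
  exact: eq_connect.
rewrite /feedback_loops; congr #|pred_of_set _|.
apply/setP=> X; apply/imsetP/imsetP=> -[s]; rewrite inE => /existsP[t];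
  [rewrite E EC | rewrite -E -EC] => st ->; exists s;
  try (by rewrite inE; apply/existsP; exists t);
  by apply/setP=> z; rewrite !inE EC.
Qed.

(** * Diagrams *)

Section Diagrams.
Variables (r : nat) (ty : 'I_r -> nat * nat).
Implicit Types (B O I X M : finType).

(* A box labelled x_i has (ty i).1 output slots and (ty i).2 input slots. *)
Definition n_out (i : 'I_r) : nat := (ty i).1.
Definition n_in (i : 'I_r) : nat := (ty i).2.

(* The disjoint union of the global endpoints [X] and of the slots of all
   boxes; [ar] is [n_out] or [n_in]. *)
Definition port (X B : finType) (lab : B -> 'I_r) (ar : 'I_r -> nat) :
    finType :=
  (X + {b : B & 'I_(ar (lab b))})%type.

(* Global outputs and inputs are indexed by finite types [O] and [I], so that
   sums of index types can be used as intermediate steps; [Con p q] below only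
   uses ordinals. *)
Record diagram (B O I : finType) := Diagram {
  lab : B -> 'I_r;
  strings : port I lab n_out -> port O lab n_in;
  strings_bij : bijective strings;
  loops : nat
}.

Arguments lab {B O I} d b.
Arguments strings {B O I} d u.

Section Slots.
Variables (B B' : finType) (l : B -> 'I_r) (l' : B' -> 'I_r).
Variables (e : B -> B') (le : forall b, l' (e b) = l b).

Definition port_map (X : finType) (ar : 'I_r -> nat) (u : port X l ar) :
    port X l' ar :=
  match u with
  | inl x => inl x
  | inr s => inr (Tagged (fun b => 'I_(ar (l' b)))
                    (cast_ord (congr1 ar (esym (le (tag s)))) (tagged s)))
  end.

End Slots.

Arguments port_map {B B' l l' e} le {X ar} u.

Definition isomorphic (B B' O I : finType)
    (D : diagram B O I) (D' : diagram B' O I) : Prop :=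
  exists (e : B -> B') (le : forall b, lab D' (e b) = lab D b),
    [/\ bijective e,
        forall u, strings D' (port_map le u) = port_map le (strings D u)
      & loops D' = loops D].

Definition port_code (X B : finType) (l : B -> 'I_r) ar (u : port X l ar) :
    X + B * nat :=
  match u with
  | inl x => inl x
  | inr s => inr (tag s, nat_of_ord (tagged s))
  end.

Lemma port_code_inj X B l ar : injective (@port_code X B l ar).
Proof.
move=> [x|[b k]] [y|[c m]] //= []; first by move->.
by move=> bc; case: c / bc m => m /val_inj ->.
Qed.

Lemma port_code_map X B B' l l' e le ar u :
  port_code (@port_map B B' l l' e le X ar u) =
  match port_code u with inl x => inl x | inr (b, k) => inr (e b, k) end.
Proof. by case: u. Qed.

Lemma isomorphic_refl B O I (D : diagram B O I) : isomorphic D D.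
Proof.
exists id, (fun=> erefl); split=> //; first exact: id_bij.
have E X ar (u : port X (lab D) ar) : port_map (e := id) (fun=> erefl) u = u.
  by apply: port_code_inj; rewrite port_code_map; case: u => [|[]].
by move=> u; rewrite !E.
Qed.

Lemma isomorphic_sym B B' O I (D : diagram B O I) (D' : diagram B' O I) :
  isomorphic D D' -> isomorphic D' D.
Proof.
case=> e [le [[e' eK e'K] He Hl]].
have le' b : lab D (e' b) = lab D' b by rewrite -le e'K.
exists e', le'; split=> //; first by exists e.
have E1 X ar (u : port X (lab D) ar) : port_map le' (port_map le u) = u.
  apply: port_code_inj; rewrite !port_code_map.
  by case: u => [|[b k]] //=; rewrite eK.
have E2 X ar (u : port X (lab D') ar) : port_map le (port_map le' u) = u.
  apply: port_code_inj; rewrite !port_code_map.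
  by case: u => [|[b k]] //=; rewrite e'K.
by move=> u; rewrite -{2}[u]E2 He E1.
Qed.

Lemma isomorphic_trans B B' B'' O I (D : diagram B O I) (D' : diagram B' O I)
    (D'' : diagram B'' O I) :
  isomorphic D D' -> isomorphic D' D'' -> isomorphic D D''.
Proof.
case=> e [le [eb He Hl]] [g [lg [gb Hg Hl']]].
have lge b : lab D'' (g (e b)) = lab D b by rewrite lg le.
exists (g \o e), lge; split; [exact: bij_comp | | by rewrite Hl'].
have E X ar (u : port X (lab D) ar) :
    port_map lge u = port_map lg (port_map le u).
  by apply: port_code_inj; rewrite !port_code_map; case: u.
by move=> u; rewrite !E Hg He.
Qed.

(** ** Equivalence classes

   Every diagram is isomorphic to one whose set of boxes is an ordinal; the
   equivalence classes are those of the latter, which form a small type. *)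

Record skeleton (O I : finType) :=
  Skeleton { n_boxes : nat; skel :> diagram 'I_n_boxes O I }.

HB.instance Definition _ O I := gen_eqMixin (skeleton O I).
HB.instance Definition _ O I := gen_choiceMixin (skeleton O I).

Definition skeleton_iso (O I : finType) : rel (skeleton O I) :=
  fun D D' => `[< isomorphic D D' >].

Lemma skeleton_iso_equiv O I : equiv_class_of (@skeleton_iso O I).
Proof.
split.
- by move=> D; apply/asboolP/isomorphic_refl.
- by move=> D D'; apply/asboolP/asboolP => /isomorphic_sym.
- move=> D D' D'' /asboolP H /asboolP H'.
  by apply/asboolP/(isomorphic_trans H H').
Qed.

Canonical skeleton_iso_rel O I := EquivRelPack (@skeleton_iso_equiv O I).

Definition dclass (O I : finType) : Type := {eq_quot @skeleton_iso_rel O I}.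

HB.instance Definition _ O I := Choice.on (dclass O I).

Section Normalize.
Variables (B O I : finType) (D : diagram B O I).

Definition normalize_lab : 'I_#|B| -> 'I_r := lab D \o enum_val.

Lemma normalize_to b : normalize_lab (enum_rank b) = lab D b.
Proof. by rewrite /normalize_lab /= enum_rankK. Qed.

Lemma normalize_from i : lab D (enum_val i) = normalize_lab i.
Proof. by []. Qed.

Definition normalize_strings (u : port I normalize_lab n_out) :
    port O normalize_lab n_in :=
  port_map normalize_to (strings D (port_map normalize_from u)).

Lemma normalize_to_bij X ar :
  bijective (@port_map _ _ _ _ _ normalize_to X ar).
Proof.
exists (@port_map _ _ _ _ _ normalize_from X ar) => u;
  apply: port_code_inj; rewrite !port_code_map;
  by case: u => [|[b k]] //=; rewrite ?enum_rankK ?enum_valK.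
Qed.

Lemma normalize_from_bij X ar :
  bijective (@port_map _ _ _ _ _ normalize_from X ar).
Proof.
exists (@port_map _ _ _ _ _ normalize_to X ar) => u;
  apply: port_code_inj; rewrite !port_code_map;
  by case: u => [|[b k]] //=; rewrite ?enum_rankK ?enum_valK.
Qed.

Lemma normalize_strings_bij : bijective normalize_strings.
Proof.
apply: (bij_comp (normalize_to_bij _ _)).
exact: (bij_comp (strings_bij D) (normalize_from_bij _ _)).
Qed.

Definition normalize : skeleton O I :=
  Skeleton (Diagram normalize_strings_bij (loops D)).

Lemma normalize_iso : isomorphic D normalize.
Proof.
exists enum_rank, normalize_to; split=> //; first exact: enum_rank_bij.
move=> u /=; rewrite /normalize_strings; congr (port_map _ (strings D _)).
apply: port_code_inj; rewrite !port_code_map.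
by case: u => [|[b k]] //=; rewrite enum_rankK.
Qed.

End Normalize.

Definition cls (B O I : finType) (D : diagram B O I) : dclass O I :=
  \pi_(dclass O I) (normalize D).

(** ** Operations on diagrams *)

Section Relabel.
Variables (B O O' I I' : finType) (fO : O -> O') (fI : I' -> I).
Hypotheses (fO_bij : bijective fO) (fI_bij : bijective fI).
Variable D : diagram B O I.

Definition relabel_strings (u : port I' (lab D) n_out) :
    port O' (lab D) n_in :=
  sum_map fO id (strings D (sum_map fI id u)).

Lemma relabel_strings_bij : bijective relabel_strings.
Proof.
apply: (bij_comp (f := sum_map fO id)).
  exact: sum_map_bij fO_bij (id_bij _).
apply: (bij_comp (strings_bij D)).
exact: sum_map_bij fI_bij (id_bij _).
Qed.

Definition relabel : diagram B O' I' := Diagram relabel_strings_bij (loops D).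

End Relabel.

Section Juxtapose.
Variables (B1 B2 O1 O2 I1 I2 : finType).
Variables (D1 : diagram B1 O1 I1) (D2 : diagram B2 O2 I2).

Definition jlab (b : B1 + B2) : 'I_r :=
  match b with inl b1 => lab D1 b1 | inr b2 => lab D2 b2 end.

Definition jsplit (X1 X2 : finType) ar (u : port (X1 + X2)%type jlab ar) :
    port X1 (lab D1) ar + port X2 (lab D2) ar :=
  match u with
  | inl (inl x) => inl (inl x)
  | inl (inr x) => inr (inl x)
  | inr (existT (inl b) k) => inl (inr (existT _ b k))
  | inr (existT (inr b) k) => inr (inr (existT _ b k))
  end.

Definition jjoin (X1 X2 : finType) ar
    (u : port X1 (lab D1) ar + port X2 (lab D2) ar) :
    port (X1 + X2)%type jlab ar :=
  match u with
  | inl (inl x) => inl (inl x)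
  | inr (inl x) => inl (inr x)
  | inl (inr (existT b k)) =>
      inr (existT (fun b => 'I_(ar (jlab b))) (inl b) k)
  | inr (inr (existT b k)) =>
      inr (existT (fun b => 'I_(ar (jlab b))) (inr b) k)
  end.

Lemma jsplitK X1 X2 ar : cancel (@jsplit X1 X2 ar) (@jjoin X1 X2 ar).
Proof. by case=> [[]|[[]]]. Qed.

Lemma jjoinK X1 X2 ar : cancel (@jjoin X1 X2 ar) (@jsplit X1 X2 ar).
Proof. by case=> [[|[]]|[|[]]]. Qed.

Definition jstrings (u : port (I1 + I2)%type jlab n_out) :
    port (O1 + O2)%type jlab n_in :=
  jjoin (sum_map (strings D1) (strings D2) (jsplit u)).

Lemma jstrings_bij : bijective jstrings.
Proof.
apply: (bij_comp (f := @jjoin _ _ _)).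
  by exists (@jsplit O1 O2 n_in); [exact: jjoinK | exact: jsplitK].
apply: (bij_comp (f := sum_map _ _)).
  exact: sum_map_bij (strings_bij D1) (strings_bij D2).
by exists (@jjoin I1 I2 n_out); [exact: jsplitK | exact: jjoinK].
Qed.

Definition juxtapose : diagram (B1 + B2)%type (O1 + O2)%type (I1 + I2)%type :=
  Diagram jstrings_bij (loops D1 + loops D2).

End Juxtapose.

(* Connects the global output [inr s] to the global input [inr s], for all
   [s : S]. *)
Section CloseUp.
Variables (B O I S : finType) (D : diagram B (O + S)%type (I + S)%type).

Definition close_body (u : port I (lab D) n_out + S) :
    port O (lab D) n_in + S :=
  sum_right (strings D (sum_right u)).

Lemma close_body_bij : bijective close_body.
Proof.
apply: (bij_comp (sum_right_bij _ _ _)).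
exact: (bij_comp (strings_bij D) (sum_right_bij _ _ _)).
Qed.

Definition close_up : diagram B O I :=
  Diagram (feedback_bij close_body_bij) (loops D + feedback_loops close_body).

End CloseUp.

Lemma close_up_iso (B B' O I S : finType)
    (D : diagram B (O + S)%type (I + S)%type)
    (D' : diagram B' (O + S)%type (I + S)%type) :
  isomorphic D D' -> isomorphic (close_up D) (close_up D').
Proof.
case=> e [le [eb H L]].
have Hb u : @close_body _ _ _ _ D' (sum_map (port_map le) id u) =
    sum_map (port_map le) id (@close_body _ _ _ _ D u).
  rewrite /close_body.
  have -> : sum_right (sum_map (port_map le) id u) =
    port_map le (sum_right u : port (I + S)%type _ _) by case: u => [[]|].
  by rewrite H; case: (strings D _) => [[]|].
have [H1 H2] := feedback_map (close_body_bij D) (close_body_bij D') Hb.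
by exists e, le; split=> //=; rewrite ?L ?H2.
Qed.

Definition dcomp (B1 B2 O M I : finType)
    (D1 : diagram B1 O M) (D2 : diagram B2 M I) : diagram (B1 + B2)%type O I :=
  close_up (relabel (id_bij _) (sum_swap_bij _ _) (juxtapose D1 D2)).

Definition dtrace (B M : finType) (D : diagram B M M) : diagram B 'I_0 'I_0 :=
  close_up (relabel (inr_ord0_bij _) (sum_ord0_bij _) D).

Definition djuxt (B1 B2 : finType) p1 q1 p2 q2
    (D1 : diagram B1 'I_p1 'I_q1) (D2 : diagram B2 'I_p2 'I_q2) :
    diagram (B1 + B2)%type 'I_(p1 + p2) 'I_(q1 + q2) :=
  relabel (unsplit_bij _ _) (split_bij _ _) (juxtapose D1 D2).

Section Identity.
Variable M : finType.

Definition identity_lab : void -> 'I_r := of_void 'I_r.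

Definition identity_strings (u : port M identity_lab n_out) :
    port M identity_lab n_in :=
  match u with
  | inl x => inl x
  | inr s => match tag s with end
  end.

Lemma identity_strings_bij : bijective identity_strings.
Proof.
exists (fun u : port M identity_lab n_in =>
          match u with inl x => inl x | inr s => match tag s with end end);
by case=> [|[[]]].
Qed.

Definition didentity : diagram void M M := Diagram identity_strings_bij 0.

End Identity.

Lemma juxtapose_iso B1 B2 B1' B2' O1 O2 I1 I2
    (D1 : diagram B1 O1 I1) (D2 : diagram B2 O2 I2)
    (D1' : diagram B1' O1 I1) (D2' : diagram B2' O2 I2) :
  isomorphic D1 D1' -> isomorphic D2 D2' ->
  isomorphic (juxtapose D1 D2) (juxtapose D1' D2').
Proof.
case=> e1 [le1 [eb1 H1 L1]] [e2 [le2 [eb2 H2 L2]]].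
have le b : lab (juxtapose D1' D2') (sum_map e1 e2 b) = lab (juxtapose D1 D2) b.
  by case: b.
exists (sum_map e1 e2), le; split; [exact: sum_map_bij | | by rewrite /= L1 L2].
have split_map (X1 X2 : finType) ar (u : port (X1 + X2)%type _ ar) :
    jsplit (port_map le u) =
    sum_map (port_map le1) (port_map le2) (jsplit u).
  case: u => [[x|x]|[[b|b] k]] //=; [congr inl|congr inr];
  exact: port_code_inj.
have join_map (X1 X2 : finType) ar u :
    jjoin (sum_map (port_map le1) (port_map le2) u) =
    port_map le (@jjoin _ _ _ _ _ _ D1 D2 X1 X2 ar u).
  apply: (can_inj (@jsplitK _ _ _ _ _ _ D1' D2' X1 X2 ar)).
  by rewrite split_map !jjoinK.
move=> u; rewrite /= /jstrings split_map -join_map; congr jjoin.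
by case: (jsplit u) => v /=; rewrite ?H1 ?H2.
Qed.

Lemma relabel_iso B B' O O' I I' (fO : O -> O') (fI : I' -> I)
    (fOb : bijective fO) (fIb : bijective fI)
    (D : diagram B O I) (D' : diagram B' O I) :
  isomorphic D D' -> isomorphic (relabel fOb fIb D) (relabel fOb fIb D').
Proof.
case=> e [le [eb H L]]; exists e, le; split=> // u; rewrite /= /relabel_strings.
have E (X X' : finType) (f : X -> X') ar (v : port X (lab D) ar) :
    sum_map f id (port_map le v) = port_map le (sum_map f id v : port X' _ ar).
  by case: v.
by rewrite E H E.
Qed.

Lemma cls_eq B B' O I (D : diagram B O I) (D' : diagram B' O I) :
  cls D = cls D' <-> isomorphic D D'.
Proof.
split=> [/eqmodP/asboolP H|H].
  apply: isomorphic_trans (normalize_iso D) _.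
  exact: isomorphic_trans H (isomorphic_sym (normalize_iso D')).
apply/eqmodP/asboolP.
apply: isomorphic_trans (isomorphic_sym (normalize_iso D)) _.
exact: isomorphic_trans H (normalize_iso D').
Qed.

Lemma cls_repr O I (c : dclass O I) : cls (repr c) = c.
Proof.
rewrite -[RHS]reprK; apply/eqmodP/asboolP.
exact/isomorphic_sym/normalize_iso.
Qed.

Lemma repr_cls B O I (D : diagram B O I) : isomorphic (repr (cls D)) D.
Proof. by apply/cls_eq; rewrite cls_repr. Qed.

(** ** The commutative monoid of closed diagrams *)

Lemma djuxt_iso B1 B2 B1' B2' p1 q1 p2 q2
    (D1 : diagram B1 'I_p1 'I_q1) (D2 : diagram B2 'I_p2 'I_q2)
    (D1' : diagram B1' 'I_p1 'I_q1) (D2' : diagram B2' 'I_p2 'I_q2) :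
  isomorphic D1 D1' -> isomorphic D2 D2' ->
  isomorphic (djuxt D1 D2) (djuxt D1' D2').
Proof. by move=> H1 H2; apply/relabel_iso/juxtapose_iso. Qed.

Definition closed_mul (c d : dclass 'I_0 'I_0) : dclass 'I_0 'I_0 :=
  cls (djuxt (repr c) (repr d)).

Definition closed_one : dclass 'I_0 'I_0 := cls (didentity 'I_0).

Lemma closed_iso B B' (D : diagram B 'I_0 'I_0) (D' : diagram B' 'I_0 'I_0)
    (e : B -> B') (le : forall b, lab D' (e b) = lab D b) :
  bijective e -> loops D' = loops D ->
  (forall s t, strings D (inr s) = inr t ->
     strings D' (port_map le (inr s)) = port_map le (inr t)) ->
  isomorphic D D'.
Proof.
move=> eb L H; exists e, le; split=> // -[[]//|s].
by case E: (strings D (inr s)) => [[]//|t]; exact: H.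
Qed.

Lemma closed_strings B (D : diagram B 'I_0 'I_0) s :
  exists b k, strings D (inr s) =
    inr (existT (fun b => 'I_(n_in (lab D b))) b k).
Proof. by case: (strings D (inr s)) => [[]//|[b k]]; exists b, k. Qed.

Lemma djuxtC_iso B1 B2 (D1 : diagram B1 'I_0 'I_0) (D2 : diagram B2 'I_0 'I_0) :
  isomorphic (djuxt D1 D2) (djuxt D2 D1).
Proof.
have le b : lab (djuxt D2 D1) (sum_swap b) = lab (djuxt D1 D2) b by case: b.
apply: (closed_iso (le := le)); [exact: sum_swap_bij | exact: addnC |].
case=> [[b|b] k] t; rewrite /= cast_ord_id /relabel_strings /= /jstrings /=.
  have [b' [k' E]] :=
      closed_strings (existT _ b k : {b & 'I_(n_out (lab D1 b))}).
  by rewrite E /= => -[<-]; rewrite /= cast_ord_id.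
have [b' [k' E]] := closed_strings (existT _ b k : {b & 'I_(n_out (lab D2 b))}).
by rewrite E /= => -[<-]; rewrite /= cast_ord_id.
Qed.

Lemma djuxtA_iso B1 B2 B3 (D1 : diagram B1 'I_0 'I_0)
    (D2 : diagram B2 'I_0 'I_0) (D3 : diagram B3 'I_0 'I_0) :
  isomorphic (djuxt (djuxt D1 D2) D3) (djuxt D1 (djuxt D2 D3)).
Proof.
pose e (b : (B1 + B2) + B3) : B1 + (B2 + B3) :=
  match b with
  | inl (inl b) => inl b | inl (inr b) => inr (inl b) | inr b => inr (inr b)
  end.
have le b : lab (djuxt D1 (djuxt D2 D3)) (e b) =
            lab (djuxt (djuxt D1 D2) D3) b by case: b => [[]|].
apply: (closed_iso (le := le)); [| exact: addnA |].
  pose e' (b : B1 + (B2 + B3)) : (B1 + B2) + B3 :=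
    match b with
    | inl b => inl (inl b) | inr (inl b) => inl (inr b) | inr (inr b) => inr b
    end.
  by exists e'; [case=> [[]|] | case=> [|[]]].
case=> [[[b|b]|b] k] t; rewrite /= cast_ord_id /relabel_strings /= /jstrings /=.
- have [b' [k' E]] :=
      closed_strings (existT _ b k : {b & 'I_(n_out (lab D1 b))}).
  rewrite /relabel_strings /= /jstrings /= E /= => -[<-].
  by rewrite /= cast_ord_id.
- have [b' [k' E]] :=
      closed_strings (existT _ b k : {b & 'I_(n_out (lab D2 b))}).
  rewrite /relabel_strings /= /jstrings /= E /= => -[<-].
  by rewrite /= cast_ord_id.
- have [b' [k' E]] :=
      closed_strings (existT _ b k : {b & 'I_(n_out (lab D3 b))}).
  rewrite /relabel_strings /= /jstrings /= E /= => -[<-].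
  by rewrite /= cast_ord_id.
Qed.

Lemma djuxt1_iso B (D : diagram B 'I_0 'I_0) :
  isomorphic (djuxt (didentity 'I_0) D) D.
Proof.
pose e (b : void + B) : B := match b with inl v => of_void B v | inr b => b end.
have le b : lab D (e b) = lab (djuxt (didentity 'I_0) D) b by case: b => [[]|].
apply: (closed_iso (le := le)) => //; first by exists inr => [[[]|]|].
case=> [[[]|b] k] t; rewrite /= cast_ord_id /relabel_strings /= /jstrings /=.
have [b' [k' E]] := closed_strings (existT _ b k : {b & 'I_(n_out (lab D b))}).
by rewrite E /= => -[<-]; rewrite /= cast_ord_id.
Qed.

Lemma isomorphic_empty B (D : diagram B 'I_0 'I_0) :
  (B -> False) -> loops D = 0%N -> isomorphic D (didentity 'I_0).
Proof.
move=> B0 L; pose e (b : B) : void := match B0 b with end.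
have le b : lab (didentity 'I_0) (e b) = lab D b by case: (B0 b).
apply: (closed_iso (le := le)) => //; last by case=> b; case: (B0 b).
by exists (of_void B) => [b|[]]; case: (B0 b).
Qed.

Lemma closed_mulC : commutative closed_mul.
Proof. by move=> c d; apply/cls_eq/djuxtC_iso. Qed.

Lemma closed_mulA : associative closed_mul.
Proof.
move=> c d f; apply/esym/cls_eq.
have H1 := djuxt_iso (repr_cls (djuxt (repr c) (repr d)))
             (isomorphic_refl (repr f)).
have H2 := djuxt_iso (isomorphic_refl (repr c))
             (repr_cls (djuxt (repr d) (repr f))).
apply: isomorphic_trans H1 _; apply: isomorphic_trans (isomorphic_sym H2).
exact: djuxtA_iso.
Qed.

Lemma closed_mul1 : left_id closed_one closed_mul.
Proof.
move=> c; rewrite -[RHS]cls_repr; apply/cls_eq.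
apply: isomorphic_trans (djuxt1_iso _).
exact: djuxt_iso (repr_cls _) (isomorphic_refl _).
Qed.

Lemma closed_mul_eq1 c d :
  closed_mul c d = closed_one -> c = closed_one /\ d = closed_one.
Proof.
case/cls_eq=> e [_ [_ _ /esym/eqP]]; rewrite addn_eq0 => /andP[/eqP Lc /eqP Ld].
split; rewrite -[LHS]cls_repr; apply/cls_eq/isomorphic_empty => // b.
  by case: (e (inl b)).
by case: (e (inr b)).
Qed.

Lemma closed_mul1r : right_id closed_one closed_mul.
Proof. by move=> c; rewrite closed_mulC closed_mul1. Qed.

HB.instance Definition _ := Choice_isMonomialDef.Build (dclass 'I_0 'I_0)
  closed_mulA closed_mul1 closed_mul1r closed_mul_eq1.
HB.instance Definition _ :=
  MonomialDef_isConomialDef.Build (dclass 'I_0 'I_0) closed_mulC.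

(** ** Gluing for morphisms between mixed tensor powers *)

Definition mixed_out (c b e d : nat) (x : 'I_(e + d) + 'I_(c + b)) :
    'I_(e + b) + ('I_c + 'I_d) :=
  sum_map (@unsplit e b) id
    (sum_cross (sum_map (@split e d) (@split c b) x)).

Definition mixed_in (d a f c : nat) (x : 'I_(f + a) + ('I_c + 'I_d)) :
    'I_(f + c) + 'I_(d + a) :=
  sum_map (@unsplit f c) (@unsplit d a)
    (sum_cross (sum_map (@split f a) (@sum_swap 'I_c 'I_d) x)).

Lemma mixed_out_bij c b e d : bijective (@mixed_out c b e d).
Proof.
apply: (bij_comp (sum_map_bij (unsplit_bij _ _) (id_bij _))).
apply: (bij_comp (sum_cross_bij _ _ _ _)).
exact: sum_map_bij (split_bij _ _) (split_bij _ _).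
Qed.

Lemma mixed_in_bij d a f c : bijective (@mixed_in d a f c).
Proof.
apply: (bij_comp (sum_map_bij (unsplit_bij _ _) (unsplit_bij _ _))).
apply: (bij_comp (sum_cross_bij _ _ _ _)).
exact: sum_map_bij (split_bij _ _) (sum_swap_bij _ _).
Qed.

(* [D1] stands for a morphism W^{c,d} -> W^{e,f} and [D2] for a morphism
   W^{a,b} -> W^{c,d}: the [c] outputs of [D2] are glued to the [c] inputs of
   [D1], and the [d] outputs of [D1] to the [d] inputs of [D2]. *)
Definition dmixed_comp (a b c d e f : nat) B1 B2
    (D1 : diagram B1 'I_(e + d) 'I_(f + c))
    (D2 : diagram B2 'I_(c + b) 'I_(d + a)) :
    diagram (B1 + B2)%type 'I_(e + b) 'I_(f + a) :=
  close_up (relabel (@mixed_out_bij c b e d) (@mixed_in_bij d a f c)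
    (juxtapose D1 D2)).

Definition ord_swap (a b : nat) (i : 'I_(a + b)) : 'I_(b + a) :=
  unsplit (sum_swap (split i)).

Lemma ord_swap_bij a b : bijective (@ord_swap a b).
Proof.
apply: (bij_comp (unsplit_bij _ _)).
exact: (bij_comp (sum_swap_bij _ _) (split_bij _ _)).
Qed.

(* For an endomorphism of W^{a,b}, each of the [a] outputs is joined to the
   corresponding one of the [a] inputs, and likewise for the [b] dual ones. *)
Definition dmixed_trace (a b : nat) B (D : diagram B 'I_(a + b) 'I_(b + a)) :
    diagram B 'I_0 'I_0 :=
  dtrace (relabel (id_bij _) (@ord_swap_bij a b) D).

(** ** Connected closed diagrams *)

Definition adjacent B O I (D : diagram B O I) : rel B := fun b b' =>
  [exists k : 'I_(n_out (lab D b)),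
    if strings D (inr (Tagged _ k)) is inr s then tag s == b' else false].

(* The first case is the single loop. *)
Definition connected_closed B (D : diagram B 'I_0 'I_0) : Prop :=
  (#|B| = 0%N /\ loops D = 1%N) \/
  [/\ (0 < #|B|)%N, loops D = 0%N
    & forall b b',
        connect (fun x y => adjacent D x y || adjacent D y x) b b'].

End Diagrams.

Arguments lab {r ty B O I} d b.
Arguments strings {r ty B O I} d u.
Arguments port_map {r B B' l l' e} le {X ar} u.
Arguments relabel_strings {r ty B O O' I I'} fO fI D u.
Arguments jstrings {r ty B1 B2 O1 O2 I1 I2} D1 D2 u.
Arguments close_body {r ty B O I S} D u.

(** * Linear combinations of diagrams *)

Section LinearExtension.
Variables (K : fieldType) (X Y Z : choiceType).

Definition lin_ext (op : X -> Y) (f : {malg K[X]}) : {malg K[Y]} :=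
  \sum_(x <- msupp f) << f@_x *g op x >>.

Definition bilin_ext (op : X -> Y -> Z) (f : {malg K[X]}) (g : {malg K[Y]}) :
    {malg K[Z]} :=
  \sum_(x <- msupp f) \sum_(y <- msupp g) << f@_x * g@_y *g op x y >>.

End LinearExtension.

(* The quotient of [V] by the subspace [W] has dimension [n]. *)
Definition quotient_dim (K : fieldType) (V : lmodType K) (W : V -> Prop)
    (n : nat) : Prop :=
  exists e : 'I_n -> V,
    (forall v, exists c : 'I_n -> K, W (v - \sum_i c i *: e i)) /\
    (forall c : 'I_n -> K, W (\sum_i c i *: e i) -> forall i, c i = 0).

Section Con.
Variables (r : nat) (ty : 'I_r -> nat * nat) (K : fieldType).

Definition Con (p q : nat) := {malg K[dclass ty 'I_p 'I_q]}.

(* This is [Con 0 0]; its multiplication is juxtaposition and comes from the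
   structure of commutative monoid on [dclass ty 'I_0 'I_0]. *)
Definition U := {malg K[dclass ty 'I_0 'I_0]}.

HB.instance Definition _ p q := GRing.Lmodule.on (Con p q).
HB.instance Definition _ := GRing.ComAlgebra.on U.

Definition con_comp (p q s : nat) : Con p q -> Con q s -> Con p s :=
  bilin_ext (fun (c : dclass ty 'I_p 'I_q) (d : dclass ty 'I_q 'I_s) =>
    cls (dcomp (repr c) (repr d))).

Definition con_trace (p : nat) : Con p p -> U :=
  lin_ext (fun c : dclass ty 'I_p 'I_p => cls (dtrace (repr c))).

Definition con_pair (p q : nat) (f : Con p q) (g : Con q p) : U :=
  con_trace (con_comp f g).

Definition character := {lrmorphism U -> K^o}.

Definition con_rad (chi : character) (p q : nat) (f : Con p q) : Prop :=
  forall g : Con q p, chi (con_pair f g) = 0.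

(** ** The category C_univ *)

(* [(a, b)] stands for W^{a,b}. *)
Definition hom0 (x y : nat * nat) := Con (y.1 + x.2) (y.2 + x.1).

Definition hom0_comp (x y z : nat * nat) :
    hom0 y z -> hom0 x y -> hom0 x z :=
  bilin_ext
    (fun (c : dclass ty 'I_(z.1 + y.2) 'I_(z.2 + y.1))
         (d : dclass ty 'I_(y.1 + x.2) 'I_(y.2 + x.1)) =>
       cls (dmixed_comp (repr c) (repr d))).

Definition hom0_trace (x : nat * nat) : hom0 x x -> U :=
  lin_ext (fun c : dclass ty 'I_(x.1 + x.2) 'I_(x.2 + x.1) =>
    cls (dmixed_trace (repr c))).

(* Objects of the additive envelope: finite families of objects W^{a,b}. *)
Record cuniv :=
  Cuniv { n_summands : nat; summand : 'I_n_summands -> nat * nat }.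

Definition chom (A B : cuniv) :=
  forall (i : 'I_(n_summands B)) (j : 'I_(n_summands A)),
    hom0 (summand j) (summand i).

Definition chom_comp (A B C : cuniv) (S : chom B C) (T : chom A B) : chom A C :=
  fun i k => \sum_j hom0_comp (S i j) (T j k).

(* The [m]-th power of [T], for [m > 0]. *)
Definition chom_pow (B : cuniv) (T : chom B B) (m : nat) : chom B B :=
  iter m.-1 (chom_comp T) T.

Definition chom_trace (B : cuniv) (T : chom B B) : U :=
  \sum_i hom0_trace (T i i).

Definition negligible (chi : character) (A B : cuniv) (T : chom A B) : Prop :=
  forall i j, con_rad chi (T i j).

Definition good (chi : character) : Prop :=
  (forall p q, exists n, quotient_dim (@con_rad chi p q) n) /\
  (forall (B : cuniv) (T : chom B B) (m : nat), (0 < m)%N ->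
     negligible chi (chom_pow T m) -> chi (chom_trace T) = 0).

(** ** Families of characters *)

Definition value (chi : character) (B : finType)
    (D : diagram ty B 'I_0 'I_0) : K :=
  chi << cls D >>.

Definition one_parameter_family (chi : K -> character) : Prop :=
  forall (B : finType) (D : diagram ty B 'I_0 'I_0),
    exists p : {poly K}, forall t, value (chi t) D = p.[t].

(* Characters are determined by their values on connected closed diagrams,
   which are added and multiplied. *)
Definition additive_family (chi : K -> character) : Prop :=
  forall (t1 t2 : K) (B : finType) (D : diagram ty B 'I_0 'I_0),
    connected_closed D ->
    value (chi t1) D + value (chi t2) D = value (chi (t1 + t2)) D.

Definition multiplicative_family (chi : K -> character) : Prop :=
  forall (t1 t2 : K) (B : finType) (D : diagram ty B 'I_0 'I_0),
    connected_closed D ->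
    value (chi t1) D * value (chi t2) D = value (chi (t1 * t2)) D.

End Con.

(* Main.v *)
(* For a fixed object B, chi_t o Tr is a trace form tau on the category algebra
   of the morphisms between the summands of B.  Call tau traceable if
   tau(x) = tr(H R(x)) for a finite-dimensional representation R and a matrix H
   commuting with it.  Traceability forces tau(T) = 0 as soon as T^m is
   negligible, and it is preserved by products of characters (Kronecker product
   of the representations).

   Bounded rank at the points s_i bounds the rank at every t, because minors are
   polynomials in t.  Where a maximal minor does not vanish, the regular
   representation of End(B)/N is given by rational functions of t, and its trace
   form is nondegenerate iff its discriminant is nonzero; that is the case at the
   good s_i (characteristic zero), hence for all but finitely many t, and then
   tau is traceable.  There are countably many objects B.

   A multiplicative family satisfies chi_t = chi_u chi_(t/u), and an additive one
   chi_t = chi_(t/q) psi_q, where psi_q sends each connected diagram to q and is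
   traceable through colourings by q colours; u, resp. q, can be chosen to avoid
   the finitely many exceptional values for B.

   Gluing of diagrams is controlled by counting colourings: closing up strings
   corresponds to summing over the colours of these strings, and two diagrams
   with the same numbers of 2-colourings are isomorphic. *)
From HB Require Import structures.
Require Import Defs.
From mathcomp Require Import all_boot all_algebra ring mxtens.
From mathcomp Require Import finmap monalg.
From mathcomp Require Import boolp classical_sets cardinality.

Set Implicit Arguments.
Unset Strict Implicit.
Unset Printing Implicit Defensive.

Import GRing.Theory.

(** * Counting colourings *)

Definition copair (A B C : Type) (f : A -> C) (g : B -> C) (x : A + B) : C :=
  match x with inl a => f a | inr b => g b end.

(** * Colourings compatible with a closed-up bijection *)

Section FeedbackColourings.
Variables (A C S : finType) (f : A + S -> C + S) (f_bij : bijective f).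
Variable (Q : finType).

Let nx := feedback_next f.

(** The same [s] colours both copies of [S], as these are identified by closing up. *)
Definition compatible (g : C -> Q) (a : A -> Q) (s : S -> Q) : bool :=
  [forall u, copair g s (f u) == copair a s u].

Lemma compatible_run g a s k (x : C + S) c : compatible g a s ->
  feedback_run f k x = Some c -> copair g s x = g c.
Proof.
move=> /forallP H; elim: k x => [|k IH] [c'|t] //=; try by case=> ->.
by move/IH <-; rewrite (eqP (H (inr t))).
Qed.

Lemma connect_nextr s t : connect nx s t -> s != t ->
  exists2 t', connect nx s t' & nx t' t.
Proof.
case/connectP=> p; elim/last_ind: p => [|p z _] /=; first by move=> _ ->; rewrite eqxx.
rewrite rcons_path last_rcons => /andP[sp zp] -> _.
by exists (last s p) => //; apply/connectP; exists p.
Qed.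

Definition cyclic (s : S) : bool := [exists t, nx s t && connect nx t s].

(** [nx] is functional, so a path leaving [s] stays on the cycle through [s], which leads back. *)
Lemma cyclic_connect s t : cyclic s -> connect nx s t -> connect nx t s.
Proof.
case/existsP=> s' /andP[ss' s's] /connectP[p].
elim: p s s' ss' s's => [|z p IH] s s' ss' s's /=.
  by move=> _ ->.
case/andP=> sz zp lt; have zs' : z = s'.
  by move: sz ss'; rewrite /nx /feedback_next => /eqP -> /eqP[].
subst z; have [ss|ss] := eqVneq s' s; first by subst s'; exact: (IH _ _ ss' s's zp lt).
have /connectP[[|s'' q] /=] := s's; first by move=> _ E; rewrite E eqxx in ss.
case/andP=> s's'' qp ql.
have cs : connect nx s'' s' .
  apply: connect_trans (connect1 ss'); apply/connectP; by exists q.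
by apply: connect_trans (IH _ _ s's'' cs zp lt) s's.
Qed.

(** From [s] to [t] this is uniqueness of successors; from [t] to [s], uniqueness of predecessors,
    which is injectivity of [f]. *)
Lemma cyclic_next s t : nx s t -> cyclic s = cyclic t.
Proof.
move=> st; apply/existsP/existsP=> -[z /andP[zs sz]].
  have zt : z = t by move: zs st; rewrite /nx /feedback_next => /eqP -> /eqP[].
  subst z; have [E|ts] := eqVneq t s; first by exists t; subst; rewrite zs /=.
  have /connectP[[|w q] /=] := sz; first by move=> _ E; rewrite E eqxx in ts.
  case/andP=> tw wq ql; exists w; rewrite tw /=.
  by apply: connect_trans (connect1 st); apply/connectP; exists q.
have [E|zt] := eqVneq z t.
  subst z; have st' : s = t.
    have [g fK _] := f_bij.
    by move: zs st; rewrite /nx /feedback_next => /eqP <- /eqP /(can_inj fK) [].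
  by exists t; move: st; rewrite st' /= => ->; exact: connect0.
have [y zy yt] := connect_nextr sz zt.
have ys : y = s.
  have [g fK _] := f_bij.
  by move: yt st; rewrite /nx /feedback_next => /eqP <- /eqP /(can_inj fK) [].
subst y; exists t; rewrite st /=.
by apply: connect_trans (connect1 zs) zy.
Qed.

(** Pigeonhole: an orbit that never leaves [S] repeats a value, so one of its elements is cyclic,
    and [cyclic_next] carries this back to [s]. *)
Lemma run_or_cyclic s : cyclic s \/
  exists k c, feedback_run f k (inr s) = Some c.
Proof.
pose step (x : C + S) := if x is inr s then f (inr s) else x.
pose w k := iter k step (inr s).
have runw k c : w k = inl c -> exists k, feedback_run f k (inr s) = Some c.
  move=> wk; exists k; move: wk; rewrite /w.
  elim: k (inr s) => [|k IH] x; first by move=> /= ->.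
  rewrite iterSr => /IH; case: x => [c'|s'] //=.
  by case: k {IH} => [|k] /=.
case: (pselect (exists k c, w k = inl c)) => [[k [c /runw[k' H]]]|N].
  by right; exists k', c.
left.
have wS k : exists s, w k = inr s.
  by case E: (w k) => [c|s']; [case: N; exists k, c | exists s'].
have /choice[z zE] := wS.
have zn k : nx (z k) (z k.+1).
  by rewrite /nx /feedback_next -zE /w iterS -/(w k) zE.
have z0 : z 0 = s by have := zE 0; rewrite /w /= => -[].
have zc i j : connect nx (z i) (z (i + j)).
  elim: j => [|j IH]; first by rewrite addn0.
  by apply: connect_trans IH _; rewrite addnS connect1.
have [i [j [ij zij]]] : exists i j, i < j /\ z i = z j.
  apply: contrapT => H.
  have inj : injective (fun i : 'I_#|S|.+1 => z i).
    move=> i j zij; apply/val_inj => /=; case: (ltngtP i j) => // ij; case: H.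
      by exists i, j.
    by exists j, i.
  by have := leq_card _ inj; rewrite card_ord ltnn.
have cyc : cyclic (z i).
  apply/existsP; exists (z i.+1); rewrite zn /= zij -(subnKC ij); exact: zc.
rewrite -z0; elim: i {ij zij} cyc => // i IH; by rewrite -(cyclic_next (zn i)).
Qed.

Lemma feedback_run_widen k l x c :
  feedback_run f k x = Some c -> feedback_run f (k + l) x = Some c.
Proof.
by elim: k x => [|k IH] [c'|s] //=; [case: l | exact: IH].
Qed.

Lemma feedback_run_det k l x c d :
  feedback_run f k x = Some c -> feedback_run f l x = Some d -> c = d.
Proof.
move=> /(feedback_run_widen l) H /(feedback_run_widen k).
by rewrite addnC H => -[].
Qed.

Lemma cyclic_prev s : cyclic s -> exists t, nx t s.
Proof.
case/existsP=> t /andP[st ts]; have [E|] := eqVneq t s.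
  by exists s; move: st; rewrite E.
by case/(connect_nextr ts) => y _ ys; exists y.
Qed.

(** On a strand that reaches [C] the colour is forced by [g] at the exit; this agrees with [a] at
    the entrances exactly when [g] composed with [feedback] is [a]. Each closed cycle has one free
    colour. *)
Lemma card_compatible (g : C -> Q) (a : A -> Q) :
  #|[set s : {ffun S -> Q} | compatible g a s]| =
  ([forall x, g (feedback f_bij x) == a x] * #|Q| ^ feedback_loops f)%N.
Proof.
case: forallP => [ga|nga]; last first.
  rewrite mul0n; apply/eqP; rewrite cards_eq0; apply/eqP/setP=> s.
  rewrite !inE; apply/negP=> H; apply: nga => x.
  rewrite -(compatible_run H (feedbackP f_bij x)).
  by have /forallP/(_ (inl x)) := H.
rewrite mul1n; set D := [set s | _].
pose L : {set {set S}} := [set [set t | connect nx s t] | s : S & cyclic s]%SET.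
have -> : feedback_loops f = #|L| by [].
(* The closed cycles; a function on [J] chooses a colour for each. *)
pose J : finType := {X : {set S} | X \in L}.
have cardJ : #|{ffun J -> Q}| = (#|Q| ^ #|L|)%N.
  by rewrite card_ffun card_sig; congr (_ ^ _)%N; apply: eq_card.
rewrite -cardJ.
have /fin_all_exists[rep repP] (j : J) : exists s,
    cyclic s /\ forall t, (t \in val j) = connect nx s t.
  have /imsetP[s] := valP j; rewrite inE => cs E; exists s; split=> // t.
  by rewrite E inE.
have cls s (cs : cyclic s) : exists j : J, s \in val j.
  have XL : [set t | connect nx s t] \in L.
    by apply/imsetP; exists s => //; rewrite inE.
  by exists (exist (fun X => X \in L) _ XL : J); rewrite /= inE connect0.
have cls_uniq s (j j' : J) : cyclic s -> s \in val j -> s \in val j' -> j = j'.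
  move=> cs sj sj'; apply/val_inj/setP=> t.
  have [cr Er] := repP j; have [cr' Er'] := repP j'.
  rewrite Er Er'; rewrite Er in sj; rewrite Er' in sj'.
  have sr := cyclic_connect cr sj; have sr' := cyclic_connect cr' sj'.
  apply/idP/idP=> H.
    exact: connect_trans sj' (connect_trans sr H).
  exact: connect_trans sj (connect_trans sr' H).
pose Phi (s : {ffun S -> Q}) := [ffun j => s (rep j)].
have const (s : {ffun S -> Q}) x y : s \in D -> connect nx x y -> s x = s y.
  rewrite inE => /forallP H /connectP[p]; elim: p x => [|z p IH] x /=.
    by move=> _ ->.
  case/andP=> xz zp yp; rewrite -(IH z) //; apply/eqP.
  by have := H (inr x); move: xz; rewrite /nx /feedback_next => /eqP -> /=; rewrite eq_sym.
(* The colours at the representatives of the cycles determine everything, since off the cycles the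
   colour is given by [g]. *)
have Phi_inj : {in D &, injective Phi}.
  move=> s s' sD s'D ss'; apply/ffunP=> x.
  case: (run_or_cyclic x) => [cx|[k [c xc]]].
    have [j xj] := cls x cx; have [_ E] := repP j; rewrite E in xj.
    rewrite -(const _ _ _ sD xj) -(const _ _ _ s'D xj).
    by have := congr1 (fun h : {ffun J -> Q} => h j) ss'; rewrite !ffunE.
  move: sD s'D; rewrite !inE => sD s'D.
  have := compatible_run sD xc; have := compatible_run s'D xc.
  by move=> /= -> ->.
rewrite -(card_in_imset Phi_inj); apply/eqP.
rewrite -[X in _ == X]cardsT; apply/eqP; congr #|pred_of_set _|.
apply/setP=> tau; rewrite inE; apply/imsetP.
(* Surjectivity: use [tau] on the cycles, and [g] at the exit elsewhere. *)
have /fin_all_exists[s sP] x : exists q : Q,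
    (cyclic x -> forall j : J, x \in val j -> q = tau j) /\
    (~~ cyclic x -> forall k c, feedback_run f k (inr x) = Some c -> q = g c).
  case cx: (cyclic x).
    have [j xj] := cls x cx; exists (tau j); split=> // _ j' xj'.
    by rewrite (cls_uniq x j j').
  case: (run_or_cyclic x) => [|[k [c xc]]]; first by rewrite cx.
  exists (g c); split=> // _ k' c' xc'.
  by rewrite (feedback_run_det xc xc').
exists [ffun x => s x].
  rewrite inE; apply/forallP=> -[x|x].
    case fx: (f (inl x)) => [c|y] /=.
      have := feedbackP f_bij x; rewrite fx; have := ga x.
      by case: #|S| => [|m] /= /eqP gx [->]; rewrite gx.
    have ncy : ~~ cyclic y.
      apply/negP=> /cyclic_prev[z]; rewrite /nx /feedback_next -fx.
      by have [f' fK _] := f_bij => /eqP/(can_inj fK).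
    have := feedbackP f_bij x; rewrite fx => /((sP y).2 ncy).
    by rewrite ffunE => ->; exact: ga.
  case fx: (f (inr x)) => [c|y] /=; rewrite !ffunE.
    have ncx : ~~ cyclic x.
      by apply/existsP=> -[t /andP[]]; rewrite /nx /feedback_next fx.
    by rewrite ((sP x).2 ncx 1 c) //= fx.
  have xy : nx x y by rewrite /nx /feedback_next fx.
  case cx: (cyclic x).
    have [j xj] := cls x cx; rewrite ((sP x).1 cx j xj).
    rewrite ((sP y).1 _ j) //; first by rewrite -(cyclic_next xy).
    have [_ E] := repP j; rewrite !E in xj *.
    exact: connect_trans xj (connect1 xy).
  have cy : cyclic y = false by rewrite -(cyclic_next xy).
  case: (run_or_cyclic y) => [|[k [c yc]]]; first by rewrite cy.
  rewrite ((sP y).2 _ k c) ?cy // ((sP x).2 _ k.+1 c) ?cx //=.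
  by rewrite fx.
apply/ffunP=> j; rewrite !ffunE; have [cr E] := repP j.
by rewrite ((sP (rep j)).1 cr j) // E connect0.
Qed.

End FeedbackColourings.

Lemma copair_ext (A B C : Type) (f f' : A -> C) (g g' : B -> C) :
  f =1 f' -> g =1 g' -> copair f g =1 copair f' g'.
Proof. by move=> ff gg [x|x] /=. Qed.

(** * Colourings of diagrams *)

Section Evaluation.
Variables (r : nat) (ty : 'I_r -> nat * nat) (Q : finType).

Definition slot (B O I : finType) (D : diagram ty B O I) (ar : 'I_r -> nat) :
  finType := {b : B & 'I_(ar (lab D b))}.

(* The number of colourings of all strings and loops of [D] which restrict to
   the given ones on the global endpoints and on the slots. *)
Definition ev (B O I : finType) (D : diagram ty B O I) (y : O -> Q) (x : I -> Q)
    (si : slot D (n_in ty) -> Q) (so : slot D (n_out ty) -> Q) : nat :=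
  [forall u, copair y si (strings D u) == copair x so u] * #|Q| ^ loops D.

Lemma eq_ev (B O I : finType) (D : diagram ty B O I) y y' x x' si si' so so' :
  y =1 y' -> x =1 x' -> si =1 si' -> so =1 so' ->
  @ev B O I D y x si so = ev y' x' si' so'.
Proof.
move=> Ey Ex Esi Eso; congr (nat_of_bool _ * _); apply: eq_forallb => u.
by rewrite (copair_ext Ey Esi) (copair_ext Ex Eso).
Qed.

(** This is [card_compatible] for [close_body]: the new loops contribute a power of [#|Q|], the open
    strands the boolean factor. *)
Lemma ev_close_up (B O I S : finType)
    (D : diagram ty B (O + S)%type (I + S)%type) y x si so :
  ev (D := close_up D) y x si so =
  \sum_(s : {ffun S -> Q}) ev (D := D) (copair y s) (copair x s) si so.
Proof.
rewrite /ev /= expnD mulnCA mulnA -mulnA.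
rewrite -(card_compatible (close_body_bij D) (copair y si) (copair x so)).
rewrite mulnC -sum1_card big_distrl /= big_mkcond /=; apply: eq_bigr => s _.
rewrite inE mul1n /compatible.
have -> : [forall u, copair (copair y si) s (close_body D u) ==
                     copair (copair x so) s u] =
    [forall u, copair (copair y s) si (strings D u) ==
               copair (copair x s) so u].
  have E (X Y : Type) (f : X -> Q) (g : Y -> Q) v :
      copair (copair f g) s (sum_right v) = copair (copair f s) g v.
    by case: v => [[]|].
  rewrite /close_body; apply/forallP/forallP=> H u; have := H (sum_right u).
    by rewrite !E; case: u => [[]|].
  by rewrite E; case: u => [[]|].
by case: ifP => _; rewrite ?mul1n.
Qed.

Lemma ev_relabel (B O O' I I' : finType) (fO : O -> O') (fI : I' -> I)
    (fOb : bijective fO) (fIb : bijective fI) (D : diagram ty B O I)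
    y x x' si so : x =1 x' \o fI ->
  ev (D := relabel fOb fIb D) y x si so = ev (D := D) (y \o fO) x' si so.
Proof.
move=> Ex; congr (nat_of_bool _ * _); have [fI' fIK fIK'] := fIb.
have E v : copair y si (sum_map fO id v) = copair (y \o fO) si v by case: v.
apply/forallP/forallP=> /= H u.
  have := H (sum_map fI' id u); rewrite /relabel_strings E.
  case: u => u //=; by rewrite Ex /= fIK'.
have := H (sum_map fI id u); rewrite /relabel_strings E.
by case: u => u //=; rewrite Ex.
Qed.

Section Juxtapose.
Variables (B1 B2 O1 O2 I1 I2 : finType).
Variables (D1 : diagram ty B1 O1 I1) (D2 : diagram ty B2 O2 I2).

Definition slot1 ar (u : slot D1 ar) : slot (juxtapose D1 D2) ar :=
  existT (fun b => 'I_(ar (jlab D1 D2 b))) (inl (tag u)) (tagged u).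

Definition slot2 ar (u : slot D2 ar) : slot (juxtapose D1 D2) ar :=
  existT (fun b => 'I_(ar (jlab D1 D2 b))) (inr (tag u)) (tagged u).

Lemma ev_juxtapose y x si so :
  ev (D := juxtapose D1 D2) y x si so =
  ev (D := D1) (y \o inl) (x \o inl) (si \o @slot1 _) (so \o @slot1 _) *
  ev (D := D2) (y \o inr) (x \o inr) (si \o @slot2 _) (so \o @slot2 _).
Proof.
rewrite /ev /= expnD mulnACA mulnb; congr (nat_of_bool _ * _).
have E1 (X1 X2 : finType) (z : X1 + X2 -> Q) ar (s : slot (juxtapose D1 D2) ar -> Q) v :
    copair z s (jjoin (inl v)) = copair (z \o inl) (s \o @slot1 _) v.
  by case: v => [|[]].
have E2 (X1 X2 : finType) (z : X1 + X2 -> Q) ar (s : slot (juxtapose D1 D2) ar -> Q) v :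
    copair z s (jjoin (inr v)) = copair (z \o inr) (s \o @slot2 _) v.
  by case: v => [|[]].
apply/forallP/andP => [H|[/forallP H1 /forallP H2] u].
  by split; apply/forallP=> u;
    [have := H (jjoin (inl u))|have := H (jjoin (inr u))];
    rewrite /jstrings jjoinK /= ?E1 ?E2.
rewrite -[u in X in _ == X]jsplitK /jstrings; case: (jsplit u) => v /=.
  by rewrite !E1.
by rewrite !E2.
Qed.
End Juxtapose.

End Evaluation.

Arguments ev {r ty Q B O I} D y x si so.

(** * Recognising isomorphisms by 2-colourings *)

Section Slots.
Variables (r : nat) (ty : 'I_r -> nat * nat).
Variables (B B' O I : finType) (D : diagram ty B O I) (D' : diagram ty B' O I).
Variables (e : B -> B') (le : forall b, lab D' (e b) = lab D b).

Definition smap ar (u : slot D ar) : slot D' ar :=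
  existT (fun b => 'I_(ar (lab D' b))) (e (tag u))
    (cast_ord (congr1 ar (esym (le (tag u)))) (tagged u)).

Lemma copair_port_map (Q X : finType) ar (y : X -> Q) (s : slot D' ar -> Q) u :
  copair y s (port_map le u) = copair y (s \o @smap ar) u.
Proof. by case: u. Qed.

Hypothesis e_bij : bijective e.

Lemma port_map_bij (X : finType) ar : bijective (@port_map r _ _ _ _ _ le X ar).
Proof.
have [e' eK e'K] := e_bij.
have le' b : lab D (e' b) = lab D' b by rewrite -le e'K.
exists (@port_map _ _ _ _ _ _ le' X ar) => u;
  apply: port_code_inj; rewrite !port_code_map;
  by case: u => [|[b k]] //=; rewrite ?eK ?e'K.
Qed.

(** Constant colourings compare the numbers of loops. To compare the strings at [u], give the colour
    [true] to its target under [D] only, and pull this back along [D'] to obtain a colouring valid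
    for [D']. Validity for [D] then says that [D'] sends [u] to the same target. *)
Lemma iso_of_ev :
  (forall (y : O -> bool) (x : I -> bool) si so,
    ev D y x (si \o @smap _) (so \o @smap _) = ev D' y x si so) ->
  isomorphic D D'.
Proof.
move=> H; exists e, le; split=> // [u|]; last first.
  have := H (fun=> true) (fun=> true) (fun=> true) (fun=> true).
  rewrite /ev.
  have E (X Y : Type) v : copair (fun _ : X => true) (fun _ : Y => true) v = true.
    by case: v.
  have E' (X : Type) ar v :
      copair (fun _ : X => true) ((fun=> true) \o @smap ar) v = true by case: v.
  case: forallP => [_|[] u]; last by rewrite !E'.
  case: forallP => [_|[] u]; last by rewrite !E.
  by rewrite !mul1n card_bool => /eqP; rewrite eqn_exp2l // => /eqP.
pose ga v := v == port_map le (strings D u).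
pose y : O -> bool := fun o => ga (inl o).
pose si (s : slot D' (n_in ty)) := ga (inr s).
have gaE v : copair y si v = ga v by case: v.
have [h hK Kh] := port_map_bij I (n_out ty).
pose al v := ga (strings D' v).
pose x : I -> bool := fun o => al (inl o).
pose so (s : slot D' (n_out ty)) := al (inr s).
have alE v : copair x so v = al v by case: v.
have := H y x si so; rewrite /ev.
have -> : [forall v, copair y si (strings D' v) == copair x so v].
  by apply/forallP=> v; rewrite gaE alE.
(* The count for [D'] is a power of 2, hence nonzero, so the colouring is valid for [D]. *)
rewrite mul1n; case: forallP => [Hu _|_ /esym/eqP]; last first.
  by rewrite mul0n expn_eq0 card_bool.
have := Hu u; rewrite -!copair_port_map gaE alE /ga /al /ga eqxx.
by rewrite eq_sym => /eqP/eqP.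
Qed.

End Slots.

Section Colourings.
Variables (Q : finType).

Definition glue m n (y : 'I_m -> Q) (z : 'I_n -> Q) (i : 'I_(m + n)) : Q :=
  copair y z (split i).

Lemma glue_split m n (y : 'I_(m + n) -> Q) :
  y =1 glue (y \o @lshift m n) (y \o @rshift m n).
Proof. by move=> i; rewrite /glue; case: split_ordP => j ->. Qed.

Lemma glue_unsplit m n (y : 'I_m -> Q) (z : 'I_n -> Q) u :
  glue y z (unsplit u) = copair y z u.
Proof. by rewrite /glue unsplitK. Qed.

Lemma glue_lshift m n (y : 'I_m -> Q) (z : 'I_n -> Q) j :
  glue y z (lshift n j) = y j.
Proof. exact: (glue_unsplit y z (inl j)). Qed.

Lemma glue_rshift m n (y : 'I_m -> Q) (z : 'I_n -> Q) j :
  glue y z (rshift m j) = z j.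
Proof. exact: (glue_unsplit y z (inr j)). Qed.

Definition glueE := (glue_lshift, glue_rshift).

Lemma sum_ffun_copair (S T : finType) (F : {ffun S + T -> Q} -> nat) :
  \sum_s F s = \sum_(s : {ffun S -> Q}) \sum_(t : {ffun T -> Q})
    F [ffun u => copair s t u].
Proof.
rewrite pair_big /=.
rewrite (reindex (fun p : {ffun S -> Q} * {ffun T -> Q} =>
  [ffun u => copair p.1 p.2 u])) //=.
exists (fun s : {ffun S + T -> Q} => ([ffun u => s (inl u)], [ffun u => s (inr u)])).
  by move=> [s t] _; congr pair; apply/ffunP=> u; rewrite !ffunE.
by move=> s _; apply/ffunP=> -[u|u]; rewrite !ffunE /= ffunE.
Qed.

Lemma sum_ffun_glue m n (F : {ffun 'I_(m + n) -> Q} -> nat) :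
  \sum_s F s = \sum_(s : {ffun 'I_m -> Q}) \sum_(t : {ffun 'I_n -> Q})
    F [ffun u => glue s t u].
Proof.
rewrite (reindex (fun s : {ffun 'I_m + 'I_n -> Q} => [ffun u => s (split u)])) /=.
  rewrite sum_ffun_copair; apply: eq_bigr => s _; apply: eq_bigr => t _.
  by congr F; apply/ffunP=> u; rewrite !ffunE.
exists (fun s : {ffun 'I_(m + n) -> Q} => [ffun u => s (unsplit u)]) => s _;
  by apply/ffunP=> u; rewrite !ffunE ?splitK ?unsplitK.
Qed.

End Colourings.

(** * Colour sums for composition and trace *)

Section EvGluing.
Variables (r : nat) (ty : 'I_r -> nat * nat) (Q : finType).
Implicit Types (B O I M : finType).

Lemma ev_didentity M (y x : M -> Q) si so :
  ev (didentity ty M) y x si so = [forall u, y u == x u].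
Proof.
rewrite /ev muln1; congr nat_of_bool; apply/forallP/forallP=> H u.
  exact: (H (inl u)).
by case: u => [u|[[]]] /=.
Qed.

(** A matrix product with rows and columns indexed by colourings; identities between glued diagrams
    thus become identities between finite sums. *)
Lemma ev_dcomp B1 B2 O M I (D1 : diagram ty B1 O M) (D2 : diagram ty B2 M I)
    (y : O -> Q) x si so :
  ev (dcomp D1 D2) y x si so =
  \sum_(s : {ffun M -> Q})
    ev D1 y s (si \o @slot1 _ _ _ _ _ _ _ _ D1 D2 _) (so \o @slot1 _ _ _ _ _ _ _ _ D1 D2 _) *
    ev D2 s x (si \o @slot2 _ _ _ _ _ _ _ _ D1 D2 _) (so \o @slot2 _ _ _ _ _ _ _ _ D1 D2 _).
Proof.
rewrite ev_close_up; apply: eq_bigr => s _.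
rewrite (@ev_relabel _ _ _ _ _ _ _ _ _ _ _ _ _ _ _ (copair s x)); last by case.
by rewrite ev_juxtapose; congr (_ * _); apply: eq_ev.
Qed.

Lemma ev_dtrace B M (D : diagram ty B M M) (y x : 'I_0 -> Q) si so :
  ev (dtrace D) y x si so = \sum_(s : {ffun M -> Q}) ev D s s si so.
Proof.
rewrite ev_close_up; apply: eq_bigr => s _.
by rewrite (@ev_relabel _ _ _ _ _ _ _ _ _ _ _ _ _ _ _ s) //; case=> [[]|].
Qed.

Lemma ev_dmixed_trace a b B (D : diagram ty B 'I_(a + b) 'I_(b + a))
    (y x : 'I_0 -> Q) si so :
  ev (dmixed_trace D) y x si so =
  \sum_(s : {ffun 'I_a -> Q}) \sum_(t : {ffun 'I_b -> Q})
    ev D (glue s t) (glue t s) si so.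
Proof.
rewrite ev_dtrace sum_ffun_glue; apply: eq_bigr => s _; apply: eq_bigr => t _.
rewrite (@ev_relabel _ _ _ _ _ _ _ _ _ _ _ _ _ _ _ (glue t s)).
  by apply: eq_ev => // i; rewrite /= ffunE.
by move=> i; rewrite /= ffunE /ord_swap glue_unsplit /glue; case: (split i).
Qed.

(** Here [s] colours the [c] strings from [D2] to [D1], and [t] the [d] strings from [D1] to
    [D2]. *)
Lemma ev_dmixed_comp a b c d e f B1 B2
    (D1 : diagram ty B1 'I_(e + d) 'I_(f + c))
    (D2 : diagram ty B2 'I_(c + b) 'I_(d + a))
    (ye : 'I_e -> Q) (yb : 'I_b -> Q) (xf : 'I_f -> Q) (xa : 'I_a -> Q) si so :
  ev (dmixed_comp D1 D2) (glue ye yb) (glue xf xa) si so =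
  \sum_(s : {ffun 'I_c -> Q}) \sum_(t : {ffun 'I_d -> Q})
    ev D1 (glue ye t) (glue xf s)
      (si \o @slot1 _ _ _ _ _ _ _ _ D1 D2 _) (so \o @slot1 _ _ _ _ _ _ _ _ D1 D2 _) *
    ev D2 (glue s yb) (glue t xa)
      (si \o @slot2 _ _ _ _ _ _ _ _ D1 D2 _) (so \o @slot2 _ _ _ _ _ _ _ _ D1 D2 _).
Proof.
rewrite ev_close_up sum_ffun_copair; apply: eq_bigr => s _; apply: eq_bigr => t _.
rewrite (@ev_relabel _ _ _ _ _ _ _ _ _ _ _ _ _ _ _
  (copair (glue xf s) (glue t xa))); last first.
  case=> [i|[i|i]]; rewrite /mixed_in /= ?glueE ?ffunE //.
  by rewrite -[LHS]/(copair _ _ (split i)); case: (split i) => j /=; rewrite !glueE.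
rewrite ev_juxtapose; congr (_ * _); apply: eq_ev => // i /=;
  rewrite /mixed_out /= -[RHS]/(copair _ _ (split i));
  case: (split i) => j //=; rewrite ?glueE ?ffunE //.
Qed.

End EvGluing.

(** * Gluing of diagrams *)

Section GluingIso.
Variables (r : nat) (ty : 'I_r -> nat * nat).

(** Both sides expand to the same fourfold sum over the colours of the glued strings, and
    [iso_of_ev] turns this equality into an isomorphism. *)
Lemma dmixed_compA_iso a b c d e f g h B1 B2 B3
    (D1 : diagram ty B1 'I_(g + f) 'I_(h + e))
    (D2 : diagram ty B2 'I_(e + d) 'I_(f + c))
    (D3 : diagram ty B3 'I_(c + b) 'I_(d + a)) :
  isomorphic (dmixed_comp D1 (dmixed_comp D2 D3))
             (dmixed_comp (dmixed_comp D1 D2) D3).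
Proof.
pose k (u : B1 + (B2 + B3)) : (B1 + B2) + B3 :=
  match u with
  | inl u => inl (inl u) | inr (inl u) => inl (inr u) | inr (inr u) => inr u
  end.
have le u : lab (dmixed_comp (dmixed_comp D1 D2) D3) (k u) =
            lab (dmixed_comp D1 (dmixed_comp D2 D3)) u by case: u => [|[]].
apply: (iso_of_ev (le := le)).
  exists (fun u : (B1 + B2) + B3 => match u with
    | inl (inl u) => inl u | inl (inr u) => inr (inl u) | inr u => inr (inr u)
    end); [by case=> [|[]] | by case=> [[]|]].
move=> y x si so.
rewrite (eq_ev (glue_split y) (glue_split x) (frefl _) (frefl _)).
rewrite [RHS](eq_ev (glue_split y) (glue_split x) (frefl _) (frefl _)).
rewrite !ev_dmixed_comp.
transitivity (\sum_(s : {ffun 'I_e -> bool}) \sum_(t : {ffun 'I_f -> bool})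
  \sum_(s' : {ffun 'I_c -> bool}) \sum_(t' : {ffun 'I_d -> bool})
  ev D1 (glue (y \o @lshift _ _) t) (glue (x \o @lshift _ _) s)
    (si \o @slot1 _ _ _ _ _ _ _ _ (dmixed_comp D1 D2) D3 _ \o
     @slot1 _ _ _ _ _ _ _ _ D1 D2 _)
    (so \o @slot1 _ _ _ _ _ _ _ _ (dmixed_comp D1 D2) D3 _ \o
     @slot1 _ _ _ _ _ _ _ _ D1 D2 _) *
  ev D2 (glue s t') (glue t s')
    (si \o @slot1 _ _ _ _ _ _ _ _ (dmixed_comp D1 D2) D3 _ \o
     @slot2 _ _ _ _ _ _ _ _ D1 D2 _)
    (so \o @slot1 _ _ _ _ _ _ _ _ (dmixed_comp D1 D2) D3 _ \o
     @slot2 _ _ _ _ _ _ _ _ D1 D2 _) *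
  ev D3 (glue s' (y \o @rshift _ _)) (glue t' (x \o @rshift _ _))
    (si \o @slot2 _ _ _ _ _ _ _ _ (dmixed_comp D1 D2) D3 _)
    (so \o @slot2 _ _ _ _ _ _ _ _ (dmixed_comp D1 D2) D3 _)).
  apply: eq_bigr => s _; apply: eq_bigr => t _.
  rewrite ev_dmixed_comp big_distrr; apply: eq_bigr => s' _.
  rewrite big_distrr; apply: eq_bigr => t' _; rewrite /= mulnA.
  congr (_ * _ * _); apply: eq_ev => // -[u v] /=;
    by rewrite /smap /= cast_ord_id.
rewrite (eq_bigr _ (fun s _ => exchange_big _ _ _ _ _ _)) exchange_big /=.
apply: eq_bigr => s' _.
under eq_bigr => s _ do rewrite exchange_big /=.
rewrite exchange_big /=; apply: eq_bigr => t' _.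
rewrite ev_dmixed_comp big_distrl; apply: eq_bigr => s _.
by rewrite big_distrl.
Qed.

Lemma dmixed_traceC_iso a b c d B1 B2
    (D1 : diagram ty B1 'I_(a + d) 'I_(b + c))
    (D2 : diagram ty B2 'I_(c + b) 'I_(d + a)) :
  isomorphic (dmixed_trace (dmixed_comp D1 D2)) (dmixed_trace (dmixed_comp D2 D1)).
Proof.
have le u : lab (dmixed_trace (dmixed_comp D2 D1)) (sum_swap u) =
            lab (dmixed_trace (dmixed_comp D1 D2)) u by case: u.
apply: (iso_of_ev (le := le)); first exact: sum_swap_bij.
move=> y x si so; rewrite !ev_dmixed_trace.
under eq_bigr => s _ do under eq_bigr => t _ do rewrite ev_dmixed_comp.
under [RHS]eq_bigr => s _ do under eq_bigr => t _ do rewrite ev_dmixed_comp.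
rewrite (eq_bigr _ (fun s _ => exchange_big _ _ _ _ _ _)) exchange_big /=.
apply: eq_bigr => s _.
under eq_bigr => t _ do rewrite exchange_big /=.
rewrite exchange_big /=; apply: eq_bigr => t _.
apply: eq_bigr => s' _; apply: eq_bigr => t' _; rewrite mulnC.
by congr (_ * _); apply: eq_ev => // -[u v] /=; rewrite /smap /= cast_ord_id.
Qed.

(** Exchanging the blocks on each side turns a diagram that pairs with morphisms from W^{a,b} to
    W^{c,d} into a morphism in the opposite direction. *)
Definition dflip a b c d B (D : diagram ty B 'I_(d + a) 'I_(c + b)) :
    diagram ty B 'I_(a + d) 'I_(b + c) :=
  relabel (@ord_swap_bij d a) (@ord_swap_bij b c) D.

Lemma ev_dflip (Q : finType) a b c d B (D : diagram ty B 'I_(d + a) 'I_(c + b))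
    (ya : 'I_a -> Q) yd xb xc si so :
  ev (dflip D) (glue ya yd) (glue xb xc) si so =
  ev D (glue yd ya) (glue xc xb) si so.
Proof.
have E m n (y : 'I_m -> Q) (z : 'I_n -> Q) u : glue y z (ord_swap u) = glue z y u.
  by rewrite /ord_swap glue_unsplit /glue; case: (split u).
rewrite (@ev_relabel _ _ _ _ _ _ _ _ _ _ _ _ _ _ _ (glue xc xb)).
  by apply: eq_ev => // u; exact: E.
by move=> u; rewrite /= E.
Qed.

(** Expresses the pairing that defines the radical as a categorical trace, so that negligibility can
    be tested on traces of composites. *)
Lemma dtrace_flip_iso a b c d B1 B2
    (D1 : diagram ty B1 'I_(c + b) 'I_(d + a))
    (D2 : diagram ty B2 'I_(d + a) 'I_(c + b)) :
  isomorphic (dtrace (dcomp D1 D2)) (dmixed_trace (dmixed_comp D1 (dflip D2))).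
Proof.
have le u : lab (dmixed_trace (dmixed_comp D1 (dflip D2))) (id u) =
            lab (dtrace (dcomp D1 D2)) u by case: u.
apply: (iso_of_ev (le := le)); first exact: id_bij.
move=> y x si so; rewrite ev_dmixed_trace ev_dtrace.
under eq_bigr => s _ do rewrite ev_dcomp sum_ffun_glue.
rewrite sum_ffun_glue; apply: eq_bigr => s _.
rewrite exchange_big; apply: eq_bigr => t _.
rewrite ev_dmixed_comp exchange_big; apply: eq_bigr => s' _; apply: eq_bigr => t' _.
rewrite ev_dflip; congr (_ * _); apply: eq_ev => [u|u|[u v]|[u v]] /=;
  rewrite ?ffunE //; try by rewrite /smap /= cast_ord_id.
Qed.

(** The identity of W^{a,b}; the swap accounts for the inputs being listed with the dual factors
    first. *)
Definition dmixed_id a b : diagram ty void 'I_(a + b) 'I_(b + a) :=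
  relabel (id_bij _) (@ord_swap_bij b a) (didentity ty 'I_(a + b)).

Lemma ev_dmixed_id (Q : finType) a b (ya xa : {ffun 'I_a -> Q})
    (yb xb : {ffun 'I_b -> Q}) si so :
  ev (dmixed_id a b) (glue ya yb) (glue xb xa) si so = (ya == xa) && (yb == xb).
Proof.
rewrite (@ev_relabel _ _ _ _ _ _ _ _ _ _ _ _ _ _ _ (glue xa xb)); last first.
  by move=> u; rewrite /= /ord_swap glue_unsplit /glue; case: (split u).
rewrite ev_didentity; congr nat_of_bool; apply/forallP/andP=> [H|[/eqP-> /eqP->]] //=.
by split; apply/eqP/ffunP=> i;
  [have := H (lshift _ i)|have := H (rshift _ i)]; rewrite /= !glueE => /eqP.
Qed.

(** The Kronecker delta of [ev_dmixed_id] leaves a single term of the sum over the glued colours. *)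
Lemma dmixed_trace1_iso a b B (D : diagram ty B 'I_(a + b) 'I_(b + a)) :
  isomorphic (dmixed_trace (dmixed_comp (dmixed_id a b) D)) (dmixed_trace D).
Proof.
pose e (u : void + B) : B := match u with inl v => of_void B v | inr u => u end.
have le u : lab (dmixed_trace D) (e u) =
            lab (dmixed_trace (dmixed_comp (dmixed_id a b) D)) u by case: u => [[]|].
apply: (iso_of_ev (le := le)); first by exists inr => [[[]|]|].
move=> y x si so; rewrite !ev_dmixed_trace.
apply: eq_bigr => s _; apply: eq_bigr => t _; rewrite ev_dmixed_comp.
rewrite (bigD1 s) //= (bigD1 t) //= ev_dmixed_id !eqxx mul1n.
rewrite big1 ?addn0; last first.
  by move=> t' /negbTE tt'; rewrite ev_dmixed_id tt' andbF.
rewrite big1 ?addn0; last first.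
  move=> s' /negbTE ss'; rewrite big1 // => t' _.
  by rewrite ev_dmixed_id [s == s']eq_sym ss'.
by apply: eq_ev => // -[u v] /=; rewrite /smap /= cast_ord_id.
Qed.

End GluingIso.

(** * Decomposition into connected diagrams *)

Section BoxColourings.
Variables (r : nat) (ty : 'I_r -> nat * nat) (Q : finType).

(* The matrix entries of [D] in the representation on [W] = the free module on
   [Q] where each box forces all its slots to carry the same colour. *)
Definition count_col B O I (D : diagram ty B O I) (y : O -> Q) (x : I -> Q) : nat :=
  \sum_(c : {ffun B -> Q}) ev D y x (fun u => c (tag u)) (fun u => c (tag u)).

Lemma eq_count_col B O I (D : diagram ty B O I) y y' x x' :
  y =1 y' -> x =1 x' -> count_col D y x = count_col D y' x'.
Proof. by move=> Ey Ex; apply: eq_bigr => c _; exact: eq_ev. Qed.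

Lemma count_col_iso B B' O I (D : diagram ty B O I) (D' : diagram ty B' O I) y x :
  isomorphic D D' -> count_col D y x = count_col D' y x.
Proof.
move=> [e [le [eb H L]]]; have [e' eK e'K] := eb.
rewrite /count_col (reindex (fun c : {ffun B' -> Q} => [ffun b => c (e b)])); last first.
  exists (fun c : {ffun B -> Q} => [ffun b => c (e' b)]) => c _;
    by apply/ffunP=> b; rewrite !ffunE ?eK ?e'K.
apply: eq_bigr => c _; rewrite /ev L; congr (nat_of_bool _ * _).
have [h hK Kh] := port_map_bij le eb I (n_out ty).
have E (X : finType) ar (z : X -> Q) (u : port X (lab D) ar) :
    copair z (fun u => [ffun b => c (e b)] (tag u)) u =
    copair z (fun u => c (tag u)) (port_map le u).
  by case: u => [|[b k]] //=; rewrite ffunE.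
apply/forallP/forallP=> C u; last by rewrite !E -H.
by have := C (h u); rewrite !E -H Kh.
Qed.

Lemma sum_juxtapose_col B1 B2 O1 O2 I1 I2 (D1 : diagram ty B1 O1 I1)
    (D2 : diagram ty B2 O2 I2) y1 x1 y2 x2 :
  \sum_(c : {ffun B1 + B2 -> Q})
    ev D1 y1 x1 ((fun u => c (tag u)) \o @slot1 _ _ _ _ _ _ _ _ D1 D2 _)
      ((fun u => c (tag u)) \o @slot1 _ _ _ _ _ _ _ _ D1 D2 _) *
    ev D2 y2 x2 ((fun u => c (tag u)) \o @slot2 _ _ _ _ _ _ _ _ D1 D2 _)
      ((fun u => c (tag u)) \o @slot2 _ _ _ _ _ _ _ _ D1 D2 _) =
  count_col D1 y1 x1 * count_col D2 y2 x2.
Proof.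
rewrite sum_ffun_copair /count_col big_distrlr /=.
apply: eq_bigr => c _; apply: eq_bigr => d _.
by congr (_ * _); apply: eq_ev => // u; rewrite /= ffunE.
Qed.

Lemma count_col_dmixed_trace a b B (D : diagram ty B 'I_(a + b) 'I_(b + a)) y x :
  count_col (dmixed_trace D) y x =
  \sum_(s : {ffun 'I_a -> Q}) \sum_(t : {ffun 'I_b -> Q})
    count_col D (glue s t) (glue t s).
Proof.
rewrite /count_col; under eq_bigr do rewrite ev_dmixed_trace.
rewrite exchange_big; apply: eq_bigr => s _; exact: exchange_big.
Qed.

Lemma count_col_dmixed_comp a b c d e f B1 B2
    (D1 : diagram ty B1 'I_(e + d) 'I_(f + c))
    (D2 : diagram ty B2 'I_(c + b) 'I_(d + a))
    (ye : 'I_e -> Q) (yb : 'I_b -> Q) (xf : 'I_f -> Q) (xa : 'I_a -> Q) :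
  count_col (dmixed_comp D1 D2) (glue ye yb) (glue xf xa) =
  \sum_(s : {ffun 'I_c -> Q}) \sum_(t : {ffun 'I_d -> Q})
    count_col D1 (glue ye t) (glue xf s) * count_col D2 (glue s yb) (glue t xa).
Proof.
rewrite {1}/count_col; under eq_bigr do rewrite ev_dmixed_comp.
rewrite exchange_big; apply: eq_bigr => s _.
by rewrite exchange_big; apply: eq_bigr => t _; rewrite sum_juxtapose_col.
Qed.

Lemma count_col_djuxt B1 B2 (D1 : diagram ty B1 'I_0 'I_0)
    (D2 : diagram ty B2 'I_0 'I_0) y x :
  count_col (djuxt D1 D2) y x = count_col D1 y x * count_col D2 y x.
Proof.
rewrite -sum_juxtapose_col; apply: eq_bigr => c _.
rewrite (@ev_relabel _ _ _ _ _ _ _ _ _ _ _ _ _ _ _ (x \o unsplit)); last by case.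
by rewrite ev_juxtapose; congr (_ * _); apply: eq_ev => // -[].
Qed.

Lemma count_col_no_box B (D : diagram ty B 'I_0 'I_0) y x :
  #|B| = 0 -> count_col D y x = #|Q| ^ loops D.
Proof.
move=> B0; have Bf (b : B) : False by have := card0_eq B0 b.
have BQ (b : B) : Q by case: (Bf b).
rewrite /count_col (bigD1 [ffun b => BQ b]) //= big1 ?addn0.
  rewrite /ev; case: forallP => [_|[]]; first by rewrite mul1n.
  by case=> [[]|[b]] //; case: (Bf b).
move=> c /eqP[]; apply/ffunP=> b; case: (Bf b).
Qed.

(** A string between two boxes forces equal colours, so by connectedness only constant colourings
    survive; the single loop has one free colour as well. *)
Lemma count_col_connected B (D : diagram ty B 'I_0 'I_0) y x :
  connected_closed D -> count_col D y x = #|Q|.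
Proof.
case=> [[B0 L]|[/card_gt0P[b0 _] L conn]].
  by rewrite count_col_no_box // L expn1.
transitivity #|[set [ffun _ : B => q] | q : Q]%SET|; last first.
  by rewrite card_imset // => q q' /ffunP/(_ b0); rewrite !ffunE.
rewrite /count_col -sum1_card [RHS]big_mkcond /=; apply: eq_bigr => c _.
rewrite /ev L muln1 -[if _ then _ else _]/(nat_of_bool _); congr nat_of_bool.
apply/forallP/imsetP=> [H|[q _ ->] u].
  exists (c b0) => //; apply/ffunP=> b; rewrite ffunE.
  have adj b1 b2 : adjacent D b1 b2 -> c b1 = c b2.
    case/existsP=> k; have := H (inr (existT (fun b => 'I_(n_out ty (lab D b))) b1 k)).
    by case: (strings D _) => [[]//|[b' k']] /= /eqP <- /eqP ->.
  have /connectP[p] := conn b0 b; elim: p (b0) => [|b2 p IH] b1 /=.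
    by move=> _ ->.
  case/andP=> b12 pp lp; rewrite (IH b2) //.
  by case/orP: b12 => /adj.
by case: (strings D u) => [[]//|v]; case: u => [[]//|u] /=; rewrite !ffunE.
Qed.

End BoxColourings.

(** * Splitting closed diagrams into components *)

Section ConnectedDecomposition.
Variables (r : nat) (ty : 'I_r -> nat * nat).

Section Restriction.
Variables (B : finType) (D : diagram ty B 'I_0 'I_0) (C : pred B).
Hypothesis C_closed : forall b k b' k',
  strings D (inr (existT (fun b => 'I_(n_out ty (lab D b))) b k)) =
  inr (existT (fun b => 'I_(n_in ty (lab D b))) b' k') -> C b = C b'.

Let BC : finType := {b : B | C b}.
Let labC (b : BC) := lab D (val b).
Let pm ar : port 'I_0 labC ar -> port 'I_0 (lab D) ar :=
  port_map (l := labC) (l' := lab D) (e := val) (fun=> erefl).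

Let pm_inj ar : injective (@pm ar).
Proof.
move=> u v /(congr1 (@port_code _ _ _ _ _)); rewrite /pm !port_code_map => E.
apply: port_code_inj; move: E.
case: u => [[]//|[b k]]; case: v => [[]//|[b' k']] /= [bb kk].
by congr (inr (_, _)) => //; exact: val_inj.
Qed.

(** By [C_closed], strings at boxes in [C] stay at boxes in [C], in both directions. As the ports
    are dependently typed, the restriction is obtained by choice and characterised through the
    injection [pm]. *)
Lemma restricted_strings_exist :
  exists f : port 'I_0 labC (n_out ty) -> port 'I_0 labC (n_in ty),
  bijective f /\ forall u, pm (f u) = strings D (pm u).
Proof.
have [g gK Kg] := strings_bij D.
have fP u : exists v, pm v = strings D (pm u).
  case: u => [[]//|[b k]] /=.
  case E: (strings D _) => [[]//|[b' k']].
  move: E; rewrite cast_ord_id => E.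
  have Cb' : C b' by rewrite -(C_closed E); exact: (valP b).
  exists (inr (existT (fun b => 'I_(n_in ty (labC b))) (exist (fun b => C b) b' Cb') k')).
  by rewrite /pm /= cast_ord_id.
have gP v : exists u, pm u = g (pm v).
  case: v => [[]//|[b' k']] /=.
  rewrite cast_ord_id.
  case E: (g _) => [[]//|[b k]].
  move/(congr1 (strings D)): E; rewrite Kg => /esym E.
  have Cb : C b by rewrite (C_closed E); exact: (valP b').
  exists (inr (existT (fun b => 'I_(n_out ty (labC b))) (exist (fun b => C b) b Cb) k)).
  by rewrite /pm /= cast_ord_id.
have /choice[f fE] := fP; have /choice[h hE] := gP.
exists f; split=> //; exists h => u; apply: pm_inj.
  by rewrite hE fE gK.
by rewrite fE hE Kg.
Qed.

Definition restricted : diagram ty BC 'I_0 'I_0 :=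
  Diagram (svalP (cid restricted_strings_exist)).1 0.

Lemma restricted_strings b k b' k' :
  strings restricted (inr (existT (fun b => 'I_(n_out ty (labC b))) b k)) =
    inr (existT (fun b => 'I_(n_in ty (labC b))) b' k') ->
  strings D (inr (existT (fun b => 'I_(n_out ty (lab D b))) (val b) k)) =
    inr (existT (fun b => 'I_(n_in ty (lab D b))) (val b') k').
Proof.
rewrite /restricted /=; case: cid => f [fb fE] /= E.
have := fE (inr (existT (fun b => 'I_(n_out ty (labC b))) b k)).
by rewrite E /pm /= !cast_ord_id.
Qed.

End Restriction.

Lemma restricted_iso (B : finType) (D : diagram ty B 'I_0 'I_0) (C : pred B)
    (C_closed : forall b k b' k',
      strings D (inr (existT (fun b => 'I_(n_out ty (lab D b))) b k)) =
      inr (existT (fun b => 'I_(n_in ty (lab D b))) b' k') -> C b = C b')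
    (C_closed' : forall b k b' k',
      strings D (inr (existT (fun b => 'I_(n_out ty (lab D b))) b k)) =
      inr (existT (fun b => 'I_(n_in ty (lab D b))) b' k') -> ~~ C b = ~~ C b') :
  loops D = 0 ->
  isomorphic (djuxt (restricted C_closed) (restricted C_closed')) D.
Proof.
move=> L; pose e (u : {b | C b} + {b | ~~ C b}) : B :=
  match u with inl u => val u | inr u => val u end.
have le u : lab D (e u) = lab (djuxt (restricted C_closed) (restricted C_closed')) u.
  by case: u.
apply: (closed_iso (le := le)); last 1 first.
- case=> [[b|b] k] t; rewrite /= cast_ord_id /relabel_strings /= /jstrings /=.
    have [b' [k' E]] := closed_strings (D := restricted C_closed) (existT _ b k).
    have E' := E; rewrite /= in E; rewrite E /= => -[<-] /=.
    by rewrite cast_ord_id; exact: restricted_strings E'.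
  have [b' [k' E]] := closed_strings (D := restricted C_closed') (existT _ b k).
  have E' := E; rewrite /= in E; rewrite E /= => -[<-] /=.
  by rewrite cast_ord_id; exact: restricted_strings E'.
- apply: inj_card_bij.
    move=> [[b Cb]|[b Cb]] [[b' Cb']|[b' Cb']] /= E.
    + by congr inl; apply: val_inj.
    + by exfalso; have := Cb'; rewrite -E Cb.
    + by exfalso; have := Cb; rewrite E Cb'.
    + by congr inr; apply: val_inj.
  rewrite card_sum !card_sig -(cardC C) leq_eqVlt; apply/orP; left; apply/eqP.
  by congr (_ + _); apply: eq_card.
- by rewrite L.
Qed.

(** Replaces the statement that [U] is generated by the connected diagrams. Induction on loops plus
    boxes: split off a loop if there is one; otherwise the diagram is empty, connected, or a
    component juxtaposed with the rest. *)
Lemma closed_diagram_ind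
    (P : forall B : finType, diagram ty B 'I_0 'I_0 -> Prop) :
  (forall B B' D D', isomorphic D D' -> @P B D -> @P B' D') ->
  P _ (didentity ty 'I_0) ->
  (forall B D, connected_closed D -> @P B D) ->
  (forall B1 B2 D1 D2, @P B1 D1 -> @P B2 D2 -> P _ (djuxt D1 D2)) ->
  forall B D, @P B D.
Proof.
move=> Piso P1 Pconn Pjuxt B D.
have [n] := ubnP (loops D + #|B|); elim: n B D => // n IH B D; rewrite ltnS => le_n.
case L: (loops D) => [|l]; last first.
  pose D' := Diagram (strings_bij D) l.
  pose LL := Diagram (identity_strings_bij ty 'I_0) 1.
  have PD' : P _ D' by apply: IH; rewrite L addSn in le_n.
  have PL : P _ LL by apply: Pconn; left; rewrite card_void.
  apply: Piso (Pjuxt _ _ _ _ PD' PL).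
  pose e (b : B + void) : B := match b with inr v => of_void B v | inl b => b end.
  have le b : lab D (e b) = lab (djuxt D' LL) b by case: b => [|[]].
  apply: (closed_iso (le := le)); last 1 first.
  - case=> [[b|[]] k] t; rewrite /= cast_ord_id /relabel_strings /= /jstrings /=.
    have [b' [k' E]] := closed_strings (D := D') (existT _ b k).
    by rewrite E /= => -[<-]; rewrite /= cast_ord_id.
  - by exists inl => [[|[]]|].
  - by rewrite /= L addn1.
have [B0|B0] := posnP #|B|.
  apply: Piso P1; apply/isomorphic_sym/isomorphic_empty => // b.
  by have := card0_eq B0 b.
pose adj : rel B := fun x y => adjacent D x y || adjacent D y x.
have adjC : connect_sym adj.
  by apply: sym_connect_sym => x y; rewrite /adj orbC.
have [conn|] := pselect (forall b b', connect adj b b').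
  by apply: Pconn; right.
move=> /existsNP[b0 /existsNP[b1 b01]].
(* The component of [b0] misses [b1], so both parts have fewer boxes. *)
pose C := connect adj b0.
have C_closed b k b' k' :
    strings D (inr (existT (fun b => 'I_(n_out ty (lab D b))) b k)) =
    inr (existT (fun b => 'I_(n_in ty (lab D b))) b' k') -> C b = C b'.
  move=> E; apply: same_connect_r => //; apply: connect1; apply/orP; left.
  by apply/existsP; exists k; rewrite E /=.
have C_closed' b k b' k' :
    strings D (inr (existT (fun b => 'I_(n_out ty (lab D b))) b k)) =
    inr (existT (fun b => 'I_(n_in ty (lab D b))) b' k') -> ~~ C b = ~~ C b'.
  by move/C_closed ->.
apply: Piso (restricted_iso C_closed C_closed' L) _.
rewrite L in le_n.
apply: Pjuxt; apply: IH; rewrite /= add0n card_sig; apply: leq_trans le_n;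
  rewrite add0n.
  apply: proper_card; apply/properP; split; first exact/fintype.subsetP.
  by exists b1 => //; apply/negP.
apply: proper_card; apply/properP; split; first exact/fintype.subsetP.
by exists b0 => //; rewrite inE negbK; exact: connect0.
Qed.

End ConnectedDecomposition.

Local Open Scope ring_scope.

(** * Linear algebra *)

Section MatrixTrace.
Variable K : closedFieldType.

(** Write the characteristic polynomial as u X^a with u(0) nonzero. Bezout for u and X^(a+1),
    together with Cayley-Hamilton, gives the projector onto the part where [Z] is invertible, as a
    polynomial in [Z] without constant term. *)
Lemma Fitting_idempotent n (Z : 'M[K]_n.+1) :
  exists q : {poly K}, exists m, let E := horner_mx Z ('X * q) in
    E * E = E /\ Z ^+ m * E = Z ^+ m.
Proof.
have [a [u]] := multiplicity_XsubC (char_poly Z) 0.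
rewrite monic_neq0 ?char_poly_monic //= => u0.
rewrite subr0 => Du.
(* The exponent [a.+1] provides a factor X also when [a] is 0. *)
have co : coprimep ('X ^+ a.+1) u.
  by rewrite coprimep_expl // -['X]subr0 coprimep_sym coprimep_XsubC.
have [[v w] /= vw] := Bezout_eq1_coprimepP _ _ co.
exists ('X ^+ a * v), a.
have -> : 'X * ('X ^+ a * v) = v * 'X ^+ a.+1.
  by rewrite mulrA -exprS mulrC.
have Z0 c : horner_mx Z (c * u * 'X ^+ a) = 0.
  by rewrite -mulrA -Du rmorphM /= Cayley_Hamilton mulr0.
set E := horner_mx Z _.
have EZ c : horner_mx Z (c * 'X ^+ a) * E = horner_mx Z (c * 'X ^+ a).
  rewrite -rmorphM /=; have -> : v * 'X ^+ a.+1 = 1 - w * u by rewrite -vw addrK.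
  have -> : c * 'X ^+ a * (1 - w * u) = c * 'X ^+ a - c * w * u * 'X ^+ a by ring.
  by rewrite rmorphB /= Z0 subr0.
split; first by have := EZ (v * 'X); rewrite -mulrA -exprS.
by have := EZ 1; rewrite !mul1r rmorphXn /= horner_mx_X.
Qed.

(** Zero is the only eigenvalue, so the characteristic polynomial is a power of X. *)
Lemma mxtrace_nilpotent n (Z : 'M[K]_n.+1) m : Z ^+ m = 0 -> \tr Z = 0.
Proof.
move=> Zm0.
have [s Ds] := closed_field_poly_normal (char_poly Z).
rewrite (monicP (char_poly_monic Z)) scale1r in Ds.
have s0 : all (pred1 0) s.
  apply/allP=> z zs; have: root (mxminpoly Z) z.
    by rewrite root_mxminpoly Ds root_prod_XsubC.
  have: mxminpoly Z %| 'X ^+ m.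
    by apply: mxminpoly_min; rewrite rmorphXn /= horner_mx_X.
  move=> /dvdpP[q Dq] rz; have : root ('X ^+ m : {poly K}) z.
    by rewrite Dq rootM rz orbT.
  by rewrite /root hornerXn expf_eq0 => /andP[].
have sz : size s = n.+1.
  by have := size_char_poly Z; rewrite Ds size_prod_XsubC => -[].
have := char_poly_trace Z isT; rewrite Ds /= (all_pred1P _ _ s0) sz.
rewrite big_nseq subr0 iter_mulr_1 coefXn ltn_eqF // => /eqP.
by rewrite eq_sym oppr_eq0 => /eqP.
Qed.

(** Idempotence makes the factors of the rank factorisation, multiplied in the other order, an
    identity matrix whose size is the rank. *)
Lemma mxtrace_idempotent n (E : 'M[K]_n) : E *m E = E -> \tr E = (\rank E)%:R.
Proof.
move=> EE.
rewrite -{1}(mulmx_base E) mxtrace_mulC.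
suff -> : row_base E *m col_base E = 1%:M by rewrite mxtrace1.
apply: (row_full_inj (col_base_full E)).
apply: (row_free_inj (row_base_free E)).
by rewrite mulmxA mulmx_base -mulmxA mulmx_base EE mulmx1 mulmx_base.
Qed.

Lemma mxtrace_horner n (H Z : 'M[K]_n.+1) m q :
  (forall k, \tr (H * Z ^+ (m + k)) = 0) ->
  \tr (H * horner_mx Z ('X^m * q)) = 0.
Proof.
move=> trHZ; rewrite -[q]coefK poly_def mulr_sumr rmorph_sum mulr_sumr raddf_sum.
rewrite big1 // => i _; rewrite -mul_polyC mulrCA -exprD rmorphM /= horner_mx_C.
rewrite rmorphXn /= horner_mx_X -[_%:M * _]/(_%:M *m _) mul_scalar_mx.
by rewrite -scalerAr linearZ /= trHZ mulr0.
Qed.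

(** The Fitting idempotent has no constant term as a polynomial in [Z], so its trace is 0; in
    characteristic zero its rank is then 0. *)
Lemma mxtrace_powers_eq0 (K0 : [pchar K] =i pred0) n (Z : 'M[K]_n.+1) :
  (forall k, \tr (Z ^+ k.+1) = 0) -> exists m, Z ^+ m = 0.
Proof.
move=> trZ; have [q [m [EE ZE]]] := Fitting_idempotent Z.
exists m; rewrite -ZE; suff -> : horner_mx Z ('X * q) = 0 by rewrite mulr0.
have := mxtrace_idempotent EE; have -> : \tr (horner_mx Z ('X * q)) = 0.
  by rewrite -[horner_mx _ _]mul1r -['X]expr1 mxtrace_horner // => k; rewrite mul1r.
by move/esym/eqP; have/pcharf0P-> := K0; rewrite mxrank_eq0 => /eqP.
Qed.

(** Split [H * Z] by the Fitting idempotent [E]. The part with [1 - E] is nilpotent, since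
    everything commutes. In the other part, replacing [E] by [E ^+ m.+1] turns [Z * E] into a
    polynomial in [Z] divisible by X^m, whose trace against [H] vanishes by hypothesis. *)
Lemma mxtrace_tail_eq0 n (H Z : 'M[K]_n.+1) m : H * Z = Z * H ->
  (forall k, \tr (H * Z ^+ (m + k)) = 0) -> \tr (H * Z) = 0.
Proof.
move=> HZ trHZ; have [q [l [EE ZE]]] := Fitting_idempotent Z.
set E := horner_mx Z _ in EE ZE.
have cE (Y : 'M_n.+1) : Y * Z = Z * Y -> Y * E = E * Y.
  move=> YZ; rewrite /E; elim/poly_ind: ('X * q) => [|p c IH].
    by rewrite rmorph0 mulr0 mul0r.
  rewrite rmorphD rmorphM /= horner_mx_X horner_mx_C mulrDr mulrDl mulrA IH -!mulrA.
  by rewrite YZ; congr (_ + _); have := scalar_mxC c Y.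
have Em : E = E ^+ m.+1 by elim: {trHZ}m => // m IH; rewrite exprS -IH EE.
have <- : H * Z * E + H * Z * (1 - E) = H * Z.
  by rewrite -mulrDr addrC subrK mulr1.
rewrite raddfD /= [X in X + _](_ : _ = 0) ?add0r.
  apply: (@mxtrace_nilpotent _ _ l.+1).
  have c1 : GRing.comm (H * Z) (1 - E).
    apply: commrB; first exact: commr1.
    by rewrite /GRing.comm -mulrA (cE Z) // mulrA (cE H) // mulrA.
  have E1 : (1 - E) ^+ l.+1 = 1 - E.
    elim: l {ZE} => // l IH; rewrite exprS IH mulrBr mulr1 mulrBl mul1r EE.
    by rewrite subrr subr0.
  rewrite exprMn_comm // E1 exprMn_comm // [Z ^+ _]exprS -!mulrA mulrBr mulr1 ZE.
  by rewrite subrr !mulr0.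
rewrite Em -rmorphXn /= exprMn_comm; last exact: mulrC.
rewrite -mulrA; set p := 'X ^+ _ * _.
have -> : Z * horner_mx Z p = horner_mx Z ('X * p) by rewrite [RHS]rmorphM /= horner_mx_X.
rewrite /p exprSr -mulrA mulrCA; exact: mxtrace_horner.
Qed.

End MatrixTrace.

(** * Linear extension from a basis *)

Section LinearExtension.
Variables (K : fieldType) (X : choiceType) (V : lmodType K).
Implicit Types (phi : X -> V) (f g : {malg K[X]}).

Definition mlin phi f : V := \sum_(x <- msupp f) f@_x *: phi x.

Lemma mlinEw phi f (d : {fset X}) : (msupp f `<=` d)%fset ->
  mlin phi f = \sum_(x <- d) f@_x *: phi x.
Proof.
move=> le; rewrite /mlin; apply: big_fset_incl => // x _.
by move/mcoeff_outdom ->; rewrite scale0r.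
Qed.

Lemma mlin_is_linear phi : linear (mlin phi).
Proof.
move=> a f g; pose d := (msupp f `|` msupp g)%fset.
rewrite !(@mlinEw _ _ d) ?fsubsetUl ?fsubsetUr //; last first.
  by apply: fsubset_trans (msuppD_le _ _) _; apply: fsetSU; exact: msuppZ_le.
rewrite scaler_sumr -big_split /=; apply: eq_bigr => x _.
by rewrite mcoeffD mcoeffZ scalerDl scalerA.
Qed.
HB.instance Definition _ phi := GRing.isLinear.Build K {malg K[X]} V *:%R
  (mlin phi) (mlin_is_linear phi).

Lemma mlinU phi a x : mlin phi << a *g x >> = a *: phi x.
Proof.
by rewrite (mlinEw phi (msuppU_le (k := x) (x := a))) big_seq_fset1 mcoeffUU.
Qed.

End LinearExtension.

Lemma poly_infinite_roots (K : fieldType) (s : nat -> K) (p : {poly K}) :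
  injective s -> (forall i, p.[s i] = 0) -> p = 0.
Proof.
move=> s_inj ps; apply/eqP/negP=> /negP p0.
have := @max_poly_roots _ p (mkseq s (size p)) p0.
rewrite size_mkseq ltnn mkseq_uniq // => H; suff: false by []; apply: H => //.
by apply/allP=> _ /mapP[i _ ->]; apply/eqP.
Qed.

(** * Rank of a pairing and its Gram determinants *)

Section Rank.
Variables (X Y : Type).

Definition gram (R : pzRingType) (b : X -> Y -> R) d (f : 'I_d -> X)
    (e : 'I_d -> Y) : 'M[R]_d := \matrix_(k, j) b (f k) (e j).

(* [b] has rank at most [J]. *)
Definition factors (R : pzRingType) (b : X -> Y -> R) (J : nat) : Prop :=
  exists (u : X -> 'rV[R]_J) (v : Y -> 'cV[R]_J),
    forall x y, b x y = (u x *m v y) 0 0.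

Lemma factors_widen (R : pzRingType) (b : X -> Y -> R) m n :
  (m <= n)%N -> factors b m -> factors b n.
Proof.
move/subnKC <- => -[u [v E]].
exists (fun x => row_mx (u x) 0), (fun y => col_mx (v y) 0) => x y.
by rewrite mul_row_col mul0mx addr0.
Qed.

Lemma gram_det_eq0 (K : fieldType) (b : X -> Y -> K) J d f e :
  factors b J -> (J < d)%N -> \det (@gram _ b d f e) = 0.
Proof.
move=> [u [v E]] Jd; apply/eqP/negPn/negP.
rewrite -unitfE -[_ \is a _]/(gram b f e \in unitmx) -row_free_unit /row_free.
have -> : gram b f e =
    (\matrix_(k, l) u (f k) 0 l) *m (\matrix_(l, j) v (e j) l 0).
  apply/matrixP=> k j; rewrite !mxE E mxE; apply: eq_bigr => l _.
  by rewrite !mxE.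
by move/eqP=> rk; have := mulmx_max_rank (\matrix_(k, l) u (f k) 0 l)
  (\matrix_(l, j) v (e j) l 0); rewrite rk leqNgt Jd.
Qed.

(** Start from the empty determinant, which is 1, and enlarge as long as possible; [J] bounds the
    process. The ring is general in order to include polynomials in the parameter. *)
Lemma exists_maximal_gram (R : comPzRingType) (b : X -> Y -> R) J :
  1 != 0 :> R ->
  (forall d f e, (J < d)%N -> \det (@gram _ b d f e) = 0) ->
  exists d (f : 'I_d -> X) (e : 'I_d -> Y), \det (gram b f e) != 0 /\
    forall f' e', \det (@gram _ b (d + 1) f' e') = 0.
Proof.
move=> R1 H; apply: contrapT => N.
suff P d : exists (f : 'I_d -> X) (e : 'I_d -> Y), \det (gram b f e) != 0.
  by have [f [e]] := P J.+1; rewrite H ?eqxx.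
elim: d => [|d [f [e fe]]].
  have F (A : Type) : 'I_0 -> A by case.
  by exists (F X), (F Y); rewrite det_mx00.
apply: contrapT => N'; apply: N; exists d, f, e; split=> // f' e'.
apply/eqP/negPn/negP=> Hn; apply: N'; rewrite -addn1; by exists f', e'.
Qed.

(** Border [G] by the row of [x] and the column of [y]: the larger determinant is det G times the
    Schur complement, which is therefore 0. *)
Lemma maximal_gram_factors (K : fieldType) (b : X -> Y -> K) d
    (f : 'I_d -> X) (e : 'I_d -> Y) :
  \det (gram b f e) != 0 ->
  (forall f' e', \det (@gram _ b (d + 1) f' e') = 0) ->
  forall x y, b x y =
    ((\row_j b x (e j)) *m invmx (gram b f e) *m (\col_k b (f k) y)) 0 0.
Proof.
move=> G0 B x y; set G := gram b f e.
have Gu : G \in unitmx by rewrite unitmxE unitfE.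
pose ext (A : Type) (g : 'I_d -> A) a (i : 'I_(d + 1)) :=
  match split i with inl j => g j | inr _ => a end.
have := B (ext _ f x) (ext _ e y).
set r := \row_j _; set c := \col_k _.
have -> : gram b (ext _ f x) (ext _ e y) = block_mx G c r (b x y)%:M.
  apply/matrixP=> i j; rewrite mxE /ext.
  case: (split_ordP i) => i' ->; case: (split_ordP j) => j' ->;
  rewrite ?block_mxEul ?block_mxEur ?block_mxEdl ?block_mxEdr !mxE //.
  by rewrite !ord1 eqxx.
have -> : block_mx G c r (b x y)%:M =
    block_mx G 0 r ((b x y)%:M - r *m invmx G *m c) *m
    block_mx 1%:M (invmx G *m c) 0 1%:M.
  rewrite mulmx_block !mulmx0 !mul0mx !mulmx1 !addr0 mulKVmx //.
  by rewrite mulmxA addrC subrK.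
rewrite det_mulmx det_lblock det_ublock !det1 !mulr1 => /eqP.
rewrite mulf_eq0 (negbTE G0) /= det_mx11 [X in X == 0]mxE.
by rewrite [_%:M _ _]mxE eqxx mulr1n [X in _ + X]mxE subr_eq0 => /eqP.
Qed.

End Rank.

(** * Finite rank and finite codimension of the radical *)

Section Radical.
Variables (K : fieldType) (X : choiceType) (Y : Type) (b : X -> Y -> K).

Definition left_radical (f : {malg K[X]}) : Prop :=
  forall y, mlin (fun x => b x y : K^o) f = 0.

(** The coordinates of [x] modulo the radical supply one factor, the values of the pairing on [e]
    the other. *)
Lemma factors_of_quotient_dim m : quotient_dim left_radical m -> factors b m.
Proof.
move=> [e [H _]]; have /choice[c Hc] := fun x => H << x >>.
exists (fun x => \row_i c x i),
  (fun y => \col_i mlin (fun x => b x y : K^o) (e i)) => x y.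
have /eqP := Hc x y; rewrite linearB /= mlinU subr_eq0 => /eqP.
rewrite -[1 *: _]/(1 * _) mul1r => ->; rewrite linear_sum mxE; apply: eq_bigr => i _.
by rewrite linearZ !mxE.
Qed.

(** The row elements of a maximal nonsingular Gram matrix form a basis of the quotient: they span by
    maximality and are independent by nonsingularity. *)
Lemma quotient_dim_of_factors J : factors b J -> exists n, quotient_dim left_radical n.
Proof.
move=> bJ.
have [d [f [e [G0 B]]]] := exists_maximal_gram (oner_neq0 _)
  (fun d f e => @gram_det_eq0 _ _ _ b J d f e bJ).
have E := maximal_gram_factors G0 B; set G := gram b f e in E G0.
have Gu : G \in unitmx by rewrite unitmxE unitfE.
exists d, (fun i => << f i >>); split=> [v|c Hc].
  pose c := mlin (fun x => (\row_j b x (e j)) *m invmx G) v.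
  exists (c 0) => y; rewrite linearB /=; apply/eqP; rewrite subr_eq0; apply/eqP.
  transitivity ((c *m \col_k b (f k) y) 0 0).
    rewrite /c /mlin mulmx_suml summxE; apply: eq_bigr => x _.
    by rewrite E -scalemxAl [RHS]mxE.
  rewrite [LHS]mxE [RHS]linear_sum; apply: eq_bigr => k _.
  by rewrite linearZ /= mlinU scale1r !mxE.
have cG : (\row_i c i) *m G = 0.
  apply/rowP=> j; rewrite !mxE; have := Hc (e j); rewrite linear_sum /= => cj.
  rewrite -[RHS]cj; apply: eq_bigr => i _.
  by rewrite linearZ /= mlinU scale1r !mxE.
have : \row_i c i = 0 by rewrite -(mulmxK Gu (\row_i c i)) cG mul0mx.
by move=> + i => /rowP/(_ i); rewrite !mxE.
Qed.

End Radical.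

(** * Traceable trace forms on a semigroup with zero *)

Section Traceable.
Variables (K : closedFieldType) (X : Type) (mul : X -> X -> X) (z : X).
Hypothesis mulA : associative mul.
Hypotheses (mul0x : left_zero z mul) (mulx0 : right_zero z mul).
Implicit Types (tau : X -> K) (x y : X).

Definition multiplicative_mx d (R : X -> 'M[K]_d) : Prop :=
  R z = 0 /\ forall x y, R (mul x y) = R x *m R y.

(** Size [d.+1] gives the matrices a ring structure; [traceableI] covers size 0. *)
Definition traceable tau : Prop :=
  exists d (R : X -> 'M[K]_d.+1) (H : 'M[K]_d.+1),
    [/\ multiplicative_mx R, forall x, H *m R x = R x *m H
      & forall x, tau x = \tr (H *m R x)].

(* The trace [tau] vanishes on all linear combinations of elements of [X]
   which act nilpotently on a module through which [tau] factors. *)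
Definition kills_nilpotents tau : Prop :=
  forall d (R : X -> 'M[K]_d.+1) (kap : X -> 'cV[K]_d.+1)
    (g : X -> 'rV[K]_d.+1),
  multiplicative_mx R -> kap z = 0 ->
  (forall x y, kap (mul x y) = R x *m kap y) ->
  (forall x y, tau (mul y x) = (g y *m kap x) 0 0) ->
  forall n (v : 'I_n -> K) (x : 'I_n -> X) m,
    (\sum_l v l *: R (x l)) ^+ m = 0 -> \sum_l v l * tau (x l) = 0.

Lemma traceableI n (R : X -> 'M[K]_n) (H : 'M[K]_n) tau :
  multiplicative_mx R -> (forall x, H *m R x = R x *m H) ->
  (forall x, tau x = \tr (H *m R x)) -> traceable tau.
Proof.
case: n R H => [|n] R H RM HR T; last by exists n, R, H.
exists 0, (fun=> 0), 0; split=> [|x|x]; rewrite ?mul0mx ?mulmx0 //.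
  by split=> // x y; rewrite mul0mx.
by rewrite T raddf0 /mxtrace big_ord0.
Qed.

Lemma traceable_mul tau1 tau2 :
  traceable tau1 -> traceable tau2 -> traceable (fun x => tau1 x * tau2 x).
Proof.
move=> [d1 [R1 [H1 [[Z1 M1] C1 T1]]]] [d2 [R2 [H2 [[Z2 M2] C2 T2]]]].
apply: (@traceableI _ (fun x => R1 x *t R2 x) (H1 *t H2)) => [|x|x].
- by split=> [|x y]; rewrite ?Z1 ?tens0mx // M1 M2 tensmx_mul.
- by rewrite !tensmx_mul C1 C2.
- rewrite tensmx_mul T1 T2 /mxtrace big_distrlr /=.
  rewrite pair_big /= [RHS](reindex (@mxtens_index d1.+1 d2.+1)) /=; last first.
    by exists (@mxtens_unindex _ _) => i _;
      rewrite ?mxtens_indexK ?mxtens_unindexK.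
  by apply: eq_bigr => -[i j] _; rewrite tensmxE.
Qed.

Section Regular.
Variables (tau : X -> K) (d : nat) (f e : 'I_d.+1 -> X).
Let b x y := tau (mul x y).
Hypothesis tauz : tau z = 0.
Hypothesis tauC : forall x y, tau (mul x y) = tau (mul y x).
Variable u : seq X.
Hypothesis tau1 : forall x, tau x = \sum_(l <- u) tau (mul l x).
Let G := gram b f e.
Hypothesis G0 : \det G != 0.
Hypothesis B : forall f' e', \det (@gram _ _ _ b (d.+1 + 1) f' e') = 0.

Let row x : 'rV_d.+1 := \row_j b x (e j).
Let col y : 'cV_d.+1 := \col_k b (f k) y.

Let bE x y : b x y = (row x *m invmx G *m col y) 0 0.
Proof. exact: (maximal_gram_factors G0 B). Qed.

Let Gu : G \in unitmx. Proof. by rewrite unitmxE unitfE. Qed.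

(** Left multiplication by [x] on the quotient by the radical of [b], in the basis [e]; [invmx G]
    converts pairings with [f] into coordinates. *)
Definition regular_mx x : 'M[K]_d.+1 :=
  invmx G *m \matrix_(k, j) tau (mul (f k) (mul x (e j))).

(** The trace form of the regular representation; its determinant is the discriminant. *)
Definition regular_form : 'M[K]_d.+1 :=
  \matrix_(i, j) \tr (regular_mx (mul (e i) (e j))).

Let M x : 'M_d.+1 := \matrix_(k, j) tau (mul (f k) (mul x (e j))).
(** The coordinates of [y] modulo the radical in the basis [e]. *)
Let kap y := invmx G *m col y.

Let M_col x y : M x *m kap y = col (mul x y).
Proof.
apply/colP=> k; rewrite [RHS]mxE /b mulA -/(b _ _) bE -mulmxA !mxE.
by apply: eq_bigr => j _; rewrite !mxE /b -mulA.
Qed.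

Let kapM x y : kap (mul x y) = regular_mx x *m kap y.
Proof. by rewrite /regular_mx -mulmxA -/(M x) M_col. Qed.

Let kapz : kap z = 0.
Proof.
have cz : col z = 0 by apply/colP=> k; rewrite !mxE /b mulx0.
by rewrite /kap cz mulmx0.
Qed.

Let regz : regular_mx z = 0.
Proof.
rewrite /regular_mx [X in _ *m X](_ : _ = 0) ?mulmx0 //.
by apply/matrixP=> k j; rewrite !mxE mul0x mulx0.
Qed.

Let regM x y : regular_mx (mul x y) = regular_mx x *m regular_mx y.
Proof.
 rewrite /regular_mx -mulmxA; congr (_ *m _); apply/matrixP=> k j.
have /colP/(_ k) := M_col x (mul y (e j)); rewrite [RHS]mxE /b mulA => E.
rewrite [LHS]mxE -mulA mulA -mulA in E *; rewrite mxE -mulA -E.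
rewrite !mxE; apply: eq_bigr => l _; congr (_ * _).
by rewrite !mxE; apply: eq_bigr => i _; rewrite !mxE.
Qed.

Let tau_row x y : tau (mul y x) = (row y *m kap x) 0 0.
Proof. by rewrite mulmxA -bE. Qed.

(** The sum over [u] acts as a unit under [tau], so [tau] factors through the quotient by the
    radical. *)
Let tau_kap x : tau x = \sum_j kap x j 0 * tau (e j).
Proof.
rewrite tau1 (eq_bigr _ (fun l _ => tau_row x l)).
transitivity (\sum_(l <- u) \sum_j kap x j 0 * tau (mul l (e j))).
  apply: eq_bigr => l _; rewrite [LHS]mxE; apply: eq_bigr => j _.
  by rewrite [row _ _ _]mxE mulrC.
by rewrite exchange_big; apply: eq_bigr => j _; rewrite -mulr_sumr -tau1.
Qed.

(** By [tauC] the radical is a two-sided ideal, so [regular_mx] factors through the quotient too. *)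
Let reg_kap x : regular_mx x = \sum_j kap x j 0 *: regular_mx (e j).
Proof.
rewrite /regular_mx; under eq_bigr do rewrite scalemxAr.
rewrite -mulmx_sumr; congr (_ *m _); apply/matrixP=> k i.
rewrite [LHS]mxE tauC -mulA tauC tau_row mxE summxE.
apply: eq_bigr => j _; rewrite [row _ _ _]mxE !mxE mulrC; congr (_ * _).
by rewrite /b tauC mulA tauC.
Qed.

Let tr_form (Q : 'M_d.+1) : (forall j, \tr (Q *m regular_mx (e j)) = 0) ->
  forall y, \tr (Q *m regular_mx y) = 0.
Proof.
move=> H y; rewrite reg_kap mulmx_sumr raddf_sum big1 // => j _.
by rewrite -scalemxAr /= mxtraceZ H mulr0.
Qed.

Let span_form (v : 'I_d.+1 -> K) (Q : 'M_d.+1) : Q = \sum_i v i *: regular_mx (e i) ->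
  forall j, \tr (Q *m regular_mx (e j)) = ((\row_i v i) *m regular_form) 0 j.
Proof.
move=> -> j; rewrite mulmx_suml raddf_sum mxE; apply: eq_bigr => i _.
by rewrite -scalemxAl /= mxtraceZ !mxE regM.
Qed.

(** A vector [v] in the kernel of the form gives [Z] with tr(Z R(y)) = 0 for all [y]. Then all
    powers of Z R(y) have trace 0, so Z R(y) is nilpotent and [kills_nilpotents] yields [Zy]. For y
    = f_k this reads v G^T = 0, whence v = 0. *)
Lemma regular_form_unit (K0 : [pchar K] =i pred0) :
  kills_nilpotents tau -> \det regular_form != 0.
Proof.
move=> kn; rewrite -unitfE -[_ \is a _]/(regular_form \in unitmx).
rewrite -row_free_unit; apply: inj_row_free => v vP.
pose Z := \sum_i v 0 i *: regular_mx (e i).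
have trZ y : \tr (Z *m regular_mx y) = 0.
  apply: tr_form => j; rewrite (span_form (erefl Z)).
  suff -> : \row_i v 0 i = v by rewrite vP mxE.
  by apply/rowP=> i; rewrite mxE.
have Zy y : \sum_i v 0 i * tau (mul (e i) y) = 0.
  pose W := \sum_i v 0 i *: regular_mx (mul (e i) y).
  have WE : W = Z *m regular_mx y.
    by rewrite mulmx_suml; apply: eq_bigr => i _; rewrite -scalemxAl regM.
  have [m Wm] : exists m, W ^+ m = 0.
    apply: (mxtrace_powers_eq0 K0) => k.
    (* The extra factor [y'] absorbs one factor of [W] at each step of the induction. *)
    suff trW n y' : \tr (Z *m (regular_mx y' *m W ^+ n)) = 0.
      by have := trW k y; rewrite mulmxA -WE exprS.
    elim: n y' => [|n IH] y'; first by rewrite mulmx1.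
    rewrite exprS -mulmxE [X in Z *m X]mulmxA {1}/W mulmx_sumr mulmx_suml.
    rewrite mulmx_sumr raddf_sum big1 // => i _.
    by rewrite -scalemxAr -scalemxAl -scalemxAr /= mxtraceZ -regM IH mulr0.
  exact: (kn _ _ _ _ (conj regz regM) kapz kapM (fun x y => tau_row x y) _ _ _ _ Wm).
have : v *m G^T = 0.
  apply/rowP=> k; rewrite !mxE -[RHS](Zy (f k)); apply: eq_bigr => i _.
  by rewrite !mxE /b tauC.
by move=> vG; rewrite -(mulmxK (_ : G^T \in unitmx) v) ?vG ?mul0mx ?unitmx_tr.
Qed.

(** Nondegeneracy provides [h] with tau(x) = tr(H R(x)). The commutator [D] of [H] and R(x) lies in
    the span of the R(e_j) and, by symmetry of [tau], is orthogonal to all R(y); hence it is 0. *)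
Lemma regular_traceable : \det regular_form != 0 -> traceable tau.
Proof.
move=> P0; have Pu : regular_form \in unitmx by rewrite unitmxE unitfE.
pose h : 'rV_d.+1 := (\row_j tau (e j)) *m invmx regular_form.
pose H := \sum_i h 0 i *: regular_mx (e i).
have trH x : tau x = \tr (H *m regular_mx x).
  rewrite reg_kap mulmx_sumr raddf_sum tau_kap; apply: eq_bigr => j _.
  rewrite -scalemxAr /= mxtraceZ (span_form (erefl H)); congr (_ * _).
  have -> : \row_i h 0 i = h by apply/rowP=> i; rewrite mxE.
  by rewrite mulmxKV // mxE.
exists d, regular_mx, H; split=> // x.
pose D := H *m regular_mx x - regular_mx x *m H.
have trD y : \tr (D *m regular_mx y) = 0.
  rewrite /D mulmxBl [LHS]raddfB /= -mulmxA -regM -trH -mulmxA.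
  by rewrite mxtrace_mulC -mulmxA -regM -trH tauC subrr.
have [v Dv] : exists v : 'I_d.+1 -> K, D = \sum_j v j *: regular_mx (e j).
  exists (fun j => \sum_i h 0 i * (kap (mul (e i) x) j 0 - kap (mul x (e i)) j 0)).
  rewrite /D /H mulmx_suml mulmx_sumr -sumrB.
  under [RHS]eq_bigr do rewrite scaler_suml.
  rewrite exchange_big; apply: eq_bigr => i _ /=.
  rewrite -scalemxAl -scalemxAr -scalerBr -!regM.
  rewrite [regular_mx (mul (e i) x)]reg_kap [regular_mx (mul x _)]reg_kap -sumrB.
  by rewrite scaler_sumr; apply: eq_bigr => j _; rewrite -scalerBl scalerA.
have v0 : (\row_i v i) *m regular_form = 0.
  by apply/rowP=> j; rewrite -(span_form Dv) trD mxE.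
have : \row_i v i = 0 by rewrite -(mulmxK Pu (\row_i v i)) v0 mul0mx.
move=> /rowP vi; apply/eqP; rewrite -subr_eq0 -/D Dv big1 // => i _.
by have := vi i; rewrite !mxE => ->; rewrite scale0r.
Qed.

End Regular.

(** Choose a maximal Gram matrix over the polynomials in t: it stays maximal at each t where det G
    does not vanish. The exceptional t are zeros of det G or of the discriminant cleared of
    denominators, and the points s_i show that the product of these polynomials is nonzero. *)
Lemma generically_traceable (K0 : [pchar K] =i pred0) (tau : K -> X -> K)
    (p : X -> {poly K}) (u : seq X) (s : nat -> K) (J : nat) :
  (forall t, tau t z = 0) ->
  (forall t x, tau t x = (p x).[t]) ->
  (forall t x y, tau t (mul x y) = tau t (mul y x)) ->
  (forall t x, tau t x = \sum_(l <- u) tau t (mul l x)) ->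
  injective s ->
  (forall i, factors (fun x y => tau (s i) (mul x y)) J) ->
  (forall i, kills_nilpotents (tau (s i))) ->
  exists2 D : {poly K}, D != 0 & forall t, D.[t] != 0 -> traceable (tau t).
Proof.
move=> tauz pE tauC tau1 s_inj sJ kn.
pose bp x y := p (mul x y); pose b t x y := tau t (mul x y).
have gramE t n f e : gram (b t) f e = map_mx (horner_eval t) (@gram _ _ _ bp n f e).
  by apply/matrixP=> i j; rewrite !mxE /b pE.
have det_gramE t n f e : \det (gram (b t) f e) = (\det (@gram _ _ _ bp n f e)).[t].
  by rewrite gramE det_map_mx.
have [d [f [e [G0 B]]]] : exists d (f : 'I_d -> X) (e : 'I_d -> X),
    \det (gram bp f e) != 0 /\
    forall f' e', \det (@gram _ _ _ bp (d + 1) f' e') = 0.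
  apply: (exists_maximal_gram (J := J)); first exact: oner_neq0.
  move=> n f e Jn; apply: (poly_infinite_roots s_inj) => i.
  by rewrite -det_gramE; exact: gram_det_eq0 (sJ i) Jn.
have Bt t f' e' : \det (@gram _ _ _ (b t) (d + 1) f' e') = 0.
  by rewrite det_gramE B horner0.
(* If [d] is 0, all 1x1 Gram determinants vanish, so [tau] is 0 by [tau1] and the zero
   representation serves. *)
case: d f e G0 B Bt => [|d] f e G0 B Bt.
  exists 1; first exact: oner_neq0.
  move=> t _; exists 0, (fun=> 0), 0.
  split=> [|x|x]; rewrite ?mul0mx ?mulmx0 //.
    by split=> // x y; rewrite mul0mx.
  rewrite raddf0 tau1 big1 // => l _.
  have := Bt t (fun=> l) (fun=> x); rewrite [gram _ _ _](_ : _ = (b t l x)%:M).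
    by rewrite det_scalar expr1.
  by apply/matrixP=> i j; rewrite !mxE !ord1 eqxx.
pose G := gram bp f e.
pose Mp x : 'M_d.+1 := \matrix_(k, j) p (mul (f k) (mul x (e j))).
(* The adjugate replaces the inverse of [G] to keep the entries polynomial; this scales the form by
   det G. *)
pose Pp : 'M_d.+1 := \matrix_(i, j) \tr (\adj G *m Mp (mul (e i) (e j))).
have PpE t : (\det G).[t] != 0 ->
    (\det Pp).[t] = (\det G).[t] ^+ d.+1 * \det (regular_form (tau t) f e).
  move=> Gt; rewrite -[_.[t]]/(horner_eval t _) -det_map_mx.
  rewrite [map_mx _ _](_ : _ = (\det G).[t] *: regular_form (tau t) f e) ?detZ //.
  apply/matrixP=> i j; rewrite !mxE -[LHS]/(horner_eval t _) -trace_map_mx.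
  rewrite -linearZ /= map_mxM map_mx_adj -gramE /regular_mx -/(b t) scalemxAl.
  congr (\tr (_ *m _)).
    rewrite /invmx unitmxE unitfE det_gramE Gt scalerA mulfV // scale1r //.
  by apply/matrixP=> k l; rewrite !mxE pE.
(* One point s_i with det G nonzero suffices: there the discriminant is nonzero by
   [regular_form_unit]. *)
have [i Gi] : exists i, (\det G).[s i] != 0.
  apply: contrapT => N; move/eqP: G0; apply.
  apply: (poly_infinite_roots s_inj) => i; apply/eqP/negPn/negP=> Gi.
  by apply: N; exists i.
exists (\det G * \det Pp) => [|t]; last first.
  rewrite hornerM mulf_eq0 negb_or => /andP[Gt]; rewrite PpE // mulf_eq0 negb_or.
  case/andP=> _; apply: (regular_traceable (tauz t) (tauC t) (tau1 t) _ (Bt t)).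
  by rewrite -/(b t) det_gramE.
apply/eqP=> /(congr1 (horner^~ (s i)))/eqP; apply/negP.
rewrite horner0 hornerM PpE // !mulf_neq0 ?expf_neq0 //.
apply: (regular_form_unit (tauz _) (tauC _) _ (Bt _) K0 (kn _)).
by rewrite -/(b (s i)) det_gramE.
Qed.

End Traceable.

(** * Endomorphisms of an object *)

Section GluingCongruence.
Variables (r : nat) (ty : 'I_r -> nat * nat).

Lemma dflipK_iso a b c d B (D : diagram ty B 'I_(d + a) 'I_(c + b)) :
  isomorphic (dflip (dflip D)) D.
Proof.
have le u : lab D (id u) = lab (dflip (dflip D)) u by [].
apply: (iso_of_ev (le := le)); first exact: id_bij.
move=> y x si so.
rewrite (eq_ev (glue_split y) (glue_split x) (frefl _) (frefl _)).
rewrite [RHS](eq_ev (glue_split y) (glue_split x) (frefl _) (frefl _)).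
by rewrite !ev_dflip; apply: eq_ev => // -[u v] /=; rewrite /smap /= cast_ord_id.
Qed.

Lemma dmixed_comp_iso a b c d e f B1 B2 B1' B2'
    (D1 : diagram ty B1 'I_(e + d) 'I_(f + c))
    (D2 : diagram ty B2 'I_(c + b) 'I_(d + a))
    (D1' : diagram ty B1' 'I_(e + d) 'I_(f + c))
    (D2' : diagram ty B2' 'I_(c + b) 'I_(d + a)) :
  isomorphic D1 D1' -> isomorphic D2 D2' ->
  isomorphic (dmixed_comp D1 D2) (dmixed_comp D1' D2').
Proof. by move=> H1 H2; apply/close_up_iso/relabel_iso/juxtapose_iso. Qed.

Lemma dtrace_iso (B B' M : finType) (D : diagram ty B M M) (D' : diagram ty B' M M) :
  isomorphic D D' -> isomorphic (dtrace D) (dtrace D').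
Proof. by move=> H; apply/close_up_iso/relabel_iso. Qed.

Lemma dmixed_trace_iso a b B B' (D : diagram ty B 'I_(a + b) 'I_(b + a))
    (D' : diagram ty B' 'I_(a + b) 'I_(b + a)) :
  isomorphic D D' -> isomorphic (dmixed_trace D) (dmixed_trace D').
Proof. by move=> H; apply/dtrace_iso/relabel_iso. Qed.

End GluingCongruence.

(** * The category algebra of the summands *)

Section Arrows.
Variables (r : nat) (ty : 'I_r -> nat * nat) (K : closedFieldType).
Variables (n : nat) (X : 'I_n -> nat * nat).
Implicit Types (i j k l : 'I_n) (chi : character ty K).

Definition dhom i j := dclass ty 'I_((X i).1 + (X j).2) 'I_((X i).2 + (X j).1).

Definition hom_comp i j k (c : dhom i j) (d : dhom j k) : dhom i k :=
  cls (dmixed_comp (repr c) (repr d)).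

Definition hom_trace i (c : dhom i i) : dclass ty 'I_0 'I_0 :=
  cls (dmixed_trace (repr c)).

Definition hom_flip i j (c : dclass ty 'I_((X i).2 + (X j).1) 'I_((X i).1 + (X j).2)) :
  dhom j i := cls (dflip (repr c)).

Definition hom_id i : dhom i i := cls (dmixed_id ty (X i).1 (X i).2).

Lemma hom_compA i j k l (c : dhom i j) (d : dhom j k) (e : dhom k l) :
  hom_comp c (hom_comp d e) = hom_comp (hom_comp c d) e.
Proof.
apply/cls_eq.
apply: isomorphic_trans (dmixed_comp_iso (isomorphic_refl _) (repr_cls _)) _.
apply: isomorphic_trans (dmixed_compA_iso _ _ _) _.
exact/isomorphic_sym/(dmixed_comp_iso (repr_cls _) (isomorphic_refl _)).
Qed.

Lemma hom_traceC i j (c : dhom i j) (d : dhom j i) :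
  hom_trace (hom_comp c d) = hom_trace (hom_comp d c).
Proof.
apply/cls_eq.
apply: isomorphic_trans (dmixed_trace_iso (repr_cls _)) _.
apply: isomorphic_trans (dmixed_traceC_iso _ _) _.
exact/isomorphic_sym/dmixed_trace_iso/repr_cls.
Qed.

Lemma hom_trace1 i (c : dhom i i) : hom_trace (hom_comp (hom_id i) c) = hom_trace c.
Proof.
apply/cls_eq.
apply: isomorphic_trans (dmixed_trace_iso (repr_cls _)) _.
apply: isomorphic_trans (dmixed_trace1_iso (repr c)).
exact/dmixed_trace_iso/(dmixed_comp_iso (repr_cls _) (isomorphic_refl _)).
Qed.

(** Flipping twice is the identity up to isomorphism; hence pairing with all diagrams amounts to
    composing with all arrows. *)
Lemma hom_flip_surj i j (e : dhom j i) : exists c, e = hom_flip (i := i) (j := j) c.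
Proof.
exists (cls (dflip (repr e))); rewrite -[LHS]cls_repr; apply/esym/cls_eq.
apply: isomorphic_trans (dflipK_iso (repr e)); apply: relabel_iso; exact: repr_cls.
Qed.

Lemma hom_trace_flip i j (c : dhom i j) d :
  hom_trace (hom_comp c (hom_flip d)) = cls (dtrace (dcomp (repr c) (repr d))).
Proof.
apply/cls_eq.
apply: isomorphic_trans (dmixed_trace_iso (repr_cls _)) _.
apply: isomorphic_trans (isomorphic_sym (dtrace_flip_iso _ _)).
exact/dmixed_trace_iso/(dmixed_comp_iso (isomorphic_refl _) (repr_cls _)).
Qed.

(* The partially defined composition of all morphisms between the objects
   [X i], with [None] playing the role of zero. *)
Definition arrow := option {ij : 'I_n * 'I_n & dhom ij.1 ij.2}.

Definition arr i j (c : dhom i j) : arrow :=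
  Some (existT (fun ij => dhom ij.1 ij.2) (i, j) c).

Definition amul (x y : arrow) : arrow :=
  match x, y with
  | Some (existT (i, j) c), Some (existT (k, l) d) =>
    match k =P j with
    | ReflectT e => arr (hom_comp c (ecast h (dhom h l) e d))
    | ReflectF _ => None
    end
  | _, _ => None
  end.

Arguments amul : simpl never.

Lemma amulE i j k (c : dhom i j) (d : dhom j k) :
  amul (arr c) (arr d) = arr (hom_comp c d).
Proof. by rewrite /amul /=; case: eqP => // e; rewrite eq_axiomK. Qed.

Lemma amulN i j k l (c : dhom i j) (d : dhom k l) :
  k != j -> amul (arr c) (arr d) = None.
Proof. by rewrite /amul /=; case: eqP. Qed.

Lemma amul0x : left_zero None amul. Proof. by []. Qed.

Lemma amulx0 : right_zero None amul. Proof. by case=> [[[i j] c]|]. Qed.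

Variant arrow_spec : arrow -> Type :=
  | ArrowNone : arrow_spec None
  | ArrowSome i j (c : dhom i j) : arrow_spec (arr c).

Lemma arrowP x : arrow_spec x.
Proof. by case: x => [[[i j] c]|]; constructor. Qed.

Lemma amulA : associative amul.
Proof.
move=> x y z; case: (arrowP x) => [|i j c] //; case: (arrowP y) => [|k l d] //.
case: (arrowP z) => [|m p e]; first by rewrite !amulx0.
have [kj|kj] := eqVneq k j; last first.
  rewrite (amulN _ _ kj) amul0x; have [ml|ml] := eqVneq m l.
    by move: ml e => -> e; rewrite amulE amulN.
  by rewrite (amulN _ _ ml).
move: kj d => -> d; rewrite amulE; have [ml|ml] := eqVneq m l; last first.
  by rewrite !amulN.
by move: ml e => -> e; rewrite !amulE hom_compA.
Qed.

(** The weight [w] is a parameter so that characters and colour counts are treated alike. *)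
Definition atrace (V : nmodType) (w : dclass ty 'I_0 'I_0 -> V) (x : arrow) : V :=
  match x with
  | Some (existT (i, j) c) =>
    match j =P i with
    | ReflectT e => w (hom_trace (ecast h (dhom i h) e c))
    | ReflectF _ => 0
    end
  | None => 0
  end.

Arguments atrace : simpl never.

Section Trace.
Variables (V : nmodType) (w : dclass ty 'I_0 'I_0 -> V).

Lemma atraceE i (c : dhom i i) : atrace w (arr c) = w (hom_trace c).
Proof. by rewrite /atrace /=; case: eqP => // e; rewrite eq_axiomK. Qed.

Lemma atraceN i j (c : dhom i j) : j != i -> atrace w (arr c) = 0.
Proof. by rewrite /atrace /=; case: eqP. Qed.

Lemma atraceC x y : atrace w (amul x y) = atrace w (amul y x).
Proof.
case: (arrowP x) => [|i j c]; first by rewrite amulx0.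
case: (arrowP y) => [|k l d] //.
have [kj|kj] := eqVneq k j; last first.
  rewrite (amulN _ _ kj); have [il|il] := eqVneq i l; last by rewrite amulN.
  by move: il c => -> c; rewrite amulE atraceN // eq_sym.
move: kj d => -> d; rewrite amulE; have [il|il] := eqVneq i l.
  by move: il c => -> c; rewrite amulE !atraceE hom_traceC.
by rewrite amulN // atraceN // eq_sym.
Qed.

(** The unit of the category algebra is the sum of the identities; only the identity of the target
    of [x] contributes. *)
Lemma atrace1 x :
  atrace w x = \sum_(l <- [seq arr (hom_id i) | i <- enum 'I_n]) atrace w (amul l x).
Proof.
rewrite big_map big_enum /=; case: (arrowP x) => [|i j c].
  by rewrite big1 // => i _; rewrite amulx0.
rewrite (bigD1 i) //= big1 ?addr0; last first.
  by move=> k ki; rewrite amulN // eq_sym.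
rewrite amulE; have [ji|ji] := eqVneq j i; last by rewrite !atraceN.
by move: ji c => -> c; rewrite !atraceE hom_trace1.
Qed.

End Trace.

End Arrows.

Arguments amul : simpl never.
Arguments atrace : simpl never.

Lemma malgUZ (K : fieldType) (X : choiceType) (a : K) (x : X) :
  << a *g x >> = a *: << x >> :> {malg K[X]}.
Proof. by apply/malgP=> k; rewrite mcoeffZ !mcoeffU mulrnAr mulr1. Qed.

(** * The pairing of a character on diagrams *)

Section CharacterPairing.
Variables (r : nat) (ty : 'I_r -> nat * nat) (K : fieldType).
Implicit Types (chi : character ty K).

Lemma chi_lin_ext chi (X : choiceType) (op : X -> dclass ty 'I_0 'I_0) f :
  chi (lin_ext op f) = mlin (fun x => chi << op x >> : K^o) f.
Proof.
rewrite /lin_ext raddf_sum; apply: eq_bigr => x _.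
by rewrite malgUZ [LHS](linearZ_LR chi).
Qed.

Definition cpair chi p q (c : dclass ty 'I_p 'I_q) (d : dclass ty 'I_q 'I_p) : K :=
  chi << cls (dtrace (dcomp (repr c) (repr d))) >>.

Lemma chi_con_pair chi p q (f : Con ty K p q) (g : Con ty K q p) :
  chi (con_pair f g) =
  mlin (fun d => mlin (fun c => cpair chi c d : K^o) f) g.
Proof.
rewrite /con_pair /con_trace chi_lin_ext /con_comp /bilin_ext.
rewrite linear_sum /= [RHS]/mlin.
under eq_bigr do rewrite linear_sum.
rewrite exchange_big; apply: eq_bigr => d _; rewrite [in RHS]/mlin scaler_sumr.
apply: eq_bigr => c _; rewrite /= mlinU scalerA mulrC; congr (_ *: _).
by congr (chi << _ >>); apply/cls_eq/dtrace_iso/repr_cls.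
Qed.

Lemma con_radE chi p q (f : Con ty K p q) :
  con_rad chi f <-> left_radical (@cpair chi p q) f.
Proof.
split=> [H d|H g]; last first.
  by rewrite chi_con_pair; apply: big1 => d _; rewrite H scaler0.
have := H << d >>; rewrite chi_con_pair mlinU.
by rewrite scale1r.
Qed.

End CharacterPairing.

(** * Endomorphisms as combinations of arrows *)

Section Endomorphisms.
Variables (r : nat) (ty : 'I_r -> nat * nat) (K : closedFieldType).
Variables (B : cuniv).
Let n := n_summands B.
Let X := summand (c := B).
Implicit Types (i j k l : 'I_n) (chi : character ty K).
Implicit Types (S T : chom ty K B B) (x y : arrow ty X).

Definition clin (V : lmodType K) (phi : arrow ty X -> V) T : V :=
  \sum_i \sum_j mlin (fun c : dhom ty X i j => phi (arr c)) (T i j).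

Definition chi_trace chi x : K := atrace (fun d => chi << d >> : K^o) x.

Lemma eq_clin (V : lmodType K) (phi psi : arrow ty X -> V) T :
  phi =1 psi -> clin phi T = clin psi T.
Proof.
by move=> E; congr (clin _ _); apply/funext.
Qed.

(** Three maps are allowed, to cover both a representation and its action on the vectors [kap].
    Products with mismatched middle index are [None] and contribute 0. *)
Lemma clin_mul a b c (phi1 : arrow ty X -> 'M[K]_(a, b))
    (phi2 : arrow ty X -> 'M[K]_(b, c)) (phi3 : arrow ty X -> 'M[K]_(a, c)) S T :
  phi3 None = 0 -> (forall x y, phi3 (amul x y) = phi1 x *m phi2 y) ->
  clin phi3 (chom_comp S T) = clin phi1 S *m clin phi2 T.
Proof.
move=> phi0 phiM; rewrite /clin mulmx_suml; apply: eq_bigr => i _.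
transitivity (\sum_j \sum_k mlin (fun c : dhom ty X i j => phi1 (arr c)) (S i j) *m
    mlin (fun c : dhom ty X j k => phi2 (arr c)) (T j k)).
  rewrite exchange_big; apply: eq_bigr => k _ /=.
  rewrite /chom_comp linear_sum; apply: eq_bigr => j _ /=.
  rewrite /hom0_comp /bilin_ext linear_sum [X in X *m _]/mlin mulmx_suml.
  apply: eq_bigr => u _ /=; rewrite linear_sum [X in _ *m X]/mlin mulmx_sumr.
  apply: eq_bigr => v _ /=; rewrite mlinU -scalemxAl -scalemxAr scalerA.
  by congr (_ *: _); rewrite -phiM amulE.
rewrite mulmx_suml; apply: eq_bigr => j _; rewrite [RHS]mulmx_sumr.
rewrite [RHS](bigD1 j) //= [X in _ + X]big1 ?addr0 => [|j' jj']; last first.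
  rewrite [LHS]mulmx_sumr big1 // => k _.
  rewrite /mlin mulmx_suml big1 // => u _; rewrite mulmx_sumr big1 // => v _.
  by rewrite -scalemxAl -scalemxAr -phiM amulN // phi0 !scaler0.
by rewrite [RHS]mulmx_sumr.
Qed.

Lemma chi_chom_trace chi T : chi (chom_trace T) = clin (chi_trace chi : _ -> K^o) T.
Proof.
rewrite /chom_trace raddf_sum; apply: eq_bigr => i _ /=.
rewrite (bigD1 i) //= big1 ?addr0 => [|j ji]; last first.
  by rewrite /mlin big1 // => c _; rewrite /chi_trace atraceN ?scaler0.
rewrite /hom0_trace chi_lin_ext; apply: eq_bigr => c _; congr (_ *: _).
by rewrite /chi_trace atraceE.
Qed.

(** Composing with one arrow isolates the entry of [T] in the opposite position, and
    [hom_trace_flip] identifies the trace with the pairing. *)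
Lemma negligibleP chi T : negligible chi T <->
  forall y, clin (fun x => chi_trace chi (amul x y) : K^o) T = 0.
Proof.
have single i j (e : dhom ty X j i) :
    clin (fun x => chi_trace chi (amul x (arr e)) : K^o) T =
    mlin (fun c : dhom ty X i j => chi << hom_trace (hom_comp c e) >> : K^o) (T i j).
  rewrite /clin (bigD1 i) //= [X in _ + X]big1 ?addr0 => [|i' ii']; last first.
    rewrite big1 // => j' _; rewrite /mlin big1 // => c _.
    have [jj|jj] := eqVneq j j'.
      move: jj e => -> e; rewrite amulE /chi_trace atraceN ?scaler0 //.
      by rewrite eq_sym.
    by rewrite amulN // scaler0.
  rewrite (bigD1 j) //= [X in _ + X]big1 ?addr0 => [|j' jj']; last first.
    by rewrite /mlin big1 // => c _; rewrite amulN ?scaler0 // eq_sym.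
  by apply: eq_bigr => c _; rewrite amulE /chi_trace atraceE.
split=> [H y|H i j].
  case: (arrowP y) => [|j i e].
    rewrite /clin big1 // => i _; rewrite big1 // => j _; rewrite /mlin big1 //.
    by move=> c _; rewrite amulx0 scaler0.
  have [d ->] := hom_flip_surj e; rewrite single.
  have /con_radE/(_ d) <- := H i j.
  by apply: eq_bigr => c _; rewrite hom_trace_flip.
apply/con_radE => d.
rewrite -[RHS](H (arr (hom_flip (X := X) (i := i) (j := j) d))) single.
by apply: eq_bigr => c _; rewrite hom_trace_flip.
Qed.

Definition of_arrow x : chom ty K B B := fun i j =>
  match x with
  | Some (existT ij c) =>
    match ij =P (i, j) with
    | ReflectT e => << ecast h (dhom ty X h.1 h.2) e c >>
    | ReflectF _ => 0
    end
  | None => 0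
  end.

Lemma clin_of_arrow (V : lmodType K) (phi : arrow ty X -> V) x :
  phi None = 0 -> clin phi (of_arrow x) = phi x.
Proof.
move=> phi0; case: (arrowP x) => [|i j c]; rewrite /clin.
  by rewrite big1 ?phi0 // => i _; rewrite big1 // => j _; rewrite linear0.
rewrite (bigD1 i) //= [X in _ + X]big1 ?addr0 => [|i' ii']; last first.
  rewrite big1 // => j' _; case: eqP => [e|_]; last by rewrite linear0.
  by exfalso; case: e => E; rewrite E eqxx in ii'.
rewrite (bigD1 j) //= [X in _ + X]big1 ?addr0 => [|j' jj']; last first.
  case: eqP => [e|_]; last by rewrite linear0.
  by exfalso; case: e => E; rewrite E eqxx in jj'.
by case: eqP => // e; rewrite eq_axiomK /= mlinU scale1r.
Qed.

Definition comb m (v : 'I_m -> K) (x : 'I_m -> arrow ty X) : chom ty K B B :=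
  fun i j => \sum_l v l *: of_arrow (x l) i j.

Lemma clin_comb (V : lmodType K) (phi : arrow ty X -> V) m v (x : 'I_m -> arrow ty X) :
  phi None = 0 -> clin phi (@comb m v x) = \sum_l v l *: phi (x l).
Proof.
move=> phi0; under [RHS]eq_bigr do rewrite -(clin_of_arrow _ phi0) scaler_sumr.
rewrite exchange_big; apply: eq_bigr => i _ /=.
under [RHS]eq_bigr do rewrite scaler_sumr.
rewrite exchange_big; apply: eq_bigr => j _ /=.
rewrite /comb linear_sum; apply: eq_bigr => l _ /=; exact: linearZ.
Qed.

Lemma clin_pow a (R : arrow ty X -> 'M[K]_a.+1) T m :
  multiplicative_mx (@amul r ty n X) None R ->
  clin R (chom_pow T m.+1) = clin R T ^+ m.+1.
Proof.
move=> [R0 RM]; rewrite /chom_pow /=; elim: m => [|m IH]; first by rewrite expr1.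
by rewrite iterS (clin_mul _ _ R0 RM) IH mulmxE -exprS.
Qed.

Lemma clin_mulmxl a b c (A : 'M[K]_(a, b)) (phi : arrow ty X -> 'M[K]_(b, c)) T :
  clin (fun x => A *m phi x) T = A *m clin phi T.
Proof.
rewrite /clin mulmx_sumr; apply: eq_bigr => i _; rewrite mulmx_sumr.
apply: eq_bigr => j _; rewrite /mlin mulmx_sumr; apply: eq_bigr => u _.
by rewrite scalemxAr.
Qed.

Lemma clin_mxtrace a (phi : arrow ty X -> 'M[K]_a) T :
  clin (fun x => \tr (phi x) : K^o) T = \tr (clin phi T).
Proof.
rewrite /clin raddf_sum; apply: eq_bigr => i _ /=; rewrite raddf_sum.
apply: eq_bigr => j _ /=; rewrite /mlin raddf_sum; apply: eq_bigr => u _ /=.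
by rewrite mxtraceZ.
Qed.

End Endomorphisms.

(** * Traceability and vanishing of traces for one object *)

Section Goodness.
Variables (r : nat) (ty : 'I_r -> nat * nat) (K : closedFieldType).
Variables (B : cuniv).
Let X := summand (c := B).
Implicit Types (chi : character ty K) (T : chom ty K B B).

Local Notation traceable chi_tr := (traceable (@amul r ty _ X) None chi_tr).

Definition kills_trace chi : Prop :=
  forall T m, (0 < m)%N -> negligible chi (chom_pow T m) -> chi (chom_trace T) = 0.

(** With Z = R(T), negligibility of T^(m+1) gives tr(H Z^(m+1) R(y)) = 0 for every arrow [y], hence
    tr(H Z^l) = 0 for all large l; [mxtrace_tail_eq0] concludes. *)
Lemma kills_trace_of_traceable chi : traceable (@chi_trace r ty K B chi) -> kills_trace chi.
Proof.
move=> [d [R [H [[R0 RM] HR trR]]]] T [//|m] _ /negligibleP neg.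
set Z := clin R T.
have trE T' : chi (chom_trace T') = \tr (H *m clin R T').
  rewrite chi_chom_trace -clin_mulmxl.
  by rewrite -clin_mxtrace; apply: eq_clin => x; rewrite trR.
(* One factor more than in the negligible power [m.+1], to be expanded into the R(y). *)
rewrite trE; apply: (@mxtrace_tail_eq0 _ _ _ _ m.+2) => [|k].
  rewrite -!mulmxE -clin_mulmxl /Z /clin mulmx_suml; apply: eq_bigr => i _.
  rewrite mulmx_suml; apply: eq_bigr => j _; rewrite /mlin mulmx_suml.
  by apply: eq_bigr => c _; rewrite HR scalemxAl.
have tr0 y : \tr (H *m (Z ^+ m.+1 *m R y)) = 0.
  rewrite mulmxA mxtrace_mulC /Z -(clin_pow _ _ (conj R0 RM)) -!clin_mulmxl.
  rewrite -clin_mxtrace -[RHS](neg y); apply: (@eq_clin _ _ _ _ K^o) => x.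
  by rewrite mxtrace_mulC -mulmxA -RM trR.
have -> : Z ^+ (m.+2 + k) = Z ^+ m.+1 *m Z ^+ k.+1.
  by rewrite mulmxE -exprD addnS.
rewrite -mulmxE -(clin_pow _ k (conj R0 RM)) -!clin_mulmxl.
rewrite -clin_mxtrace.
rewrite (@eq_clin _ _ _ _ _ _ (fun=> 0)); last by move=> y /=; rewrite tr0.
by rewrite /clin big1 // => i _; rewrite big1 // => j _; rewrite /mlin big1 // => c _;
  rewrite scaler0.
Qed.

(** Let T be the given combination, so R(T)^k = 0. Then kap(T^(k+1)) = R(T)^k kap(T) = 0, and
    T^(k+1) is negligible because the trace pairing factors through [kap]. *)
Lemma kills_nilpotents_of_good chi : kills_trace chi ->
  kills_nilpotents (@amul r ty _ X) None (@chi_trace r ty K B chi).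
Proof.
move=> kt d R kap g RM kap0 kapM tauE m v x k Zk.
have tau0 : @chi_trace r ty K B chi None = 0 by [].
have trE := @clin_comb r ty K B K^o (@chi_trace r ty K B chi) m v x tau0.
rewrite -[LHS]trE -chi_chom_trace; apply: (kt _ k.+1) => //.
apply/negligibleP => y.
have kapE j : clin kap (chom_pow (comb v x) j.+1) =
    clin R (comb v x) ^+ j *m clin kap (comb v x).
  elim: j => [|j IH]; first by rewrite mul1mx.
  rewrite /chom_pow /= -/(chom_pow _ j.+1) (clin_mul _ _ kap0 kapM).
  by rewrite [in LHS]IH mulmxA mulmxE -exprS.
have gk : clin (fun u => g y *m kap u) (chom_pow (comb v x) k.+1) = 0.
  by rewrite clin_mulmxl kapE clin_comb ?RM.1 // Zk mul0mx mulmx0.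
transitivity ((clin (fun u => g y *m kap u) (chom_pow (comb v x) k.+1)) 0 0).
  rewrite /clin summxE; apply: eq_bigr => i _; rewrite summxE.
  apply: eq_bigr => j _; rewrite /mlin summxE; apply: eq_bigr => c _.
  by rewrite [RHS]mxE -tauE /chi_trace atraceC.
by rewrite gk mxE.
Qed.

End Goodness.

(** * Families of characters *)

Lemma factors_fin (R : pzRingType) (X Y : Type) (P : finType) (u : X -> P -> R)
    (v : P -> Y -> R) (b : X -> Y -> R) :
  (forall x y, b x y = \sum_p u x p * v p y) -> factors b #|P|.
Proof.
move=> E; exists (fun x => \row_k u x (enum_val k)),
  (fun y => \col_k v (enum_val k) y) => x y.
rewrite E mxE (reindex_onto (@enum_val P predT) enum_rank) => [|p _].
  by apply: eq_big => [k|k _]; rewrite ?enum_valK ?eqxx // !mxE.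
by rewrite enum_rankK.
Qed.

(** * Rank of the trace pairing on arrows *)

Section ArrowRank.
Variables (r : nat) (ty : 'I_r -> nat * nat) (K : closedFieldType) (B : cuniv).
Let n := n_summands B.
Let X := summand (c := B).
Variables (chi : character ty K) (N : nat).

(** The pairing is the direct sum, over pairs of objects, of the pairings between opposite Hom
    spaces, each of rank at most [N]. *)
Lemma arrow_factors :
  (forall i j : 'I_n,
    factors (@cpair _ _ _ chi ((X i).1 + (X j).2) ((X i).2 + (X j).1)) N) ->
  factors (fun x y : arrow ty X => chi_trace chi (amul x y))
    #|{: 'I_n * 'I_n * 'I_N}|.
Proof.
move=> H.
have /fin_all_exists[u uP] (ij : 'I_n * 'I_n) := H ij.1 ij.2.
have /fin_all_exists[v vP] (ij : 'I_n * 'I_n) : exists v : dhom ty X ij.2 ij.1 -> 'cV[K]_N,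
    forall (c : dhom ty X ij.1 ij.2) d,
      chi << hom_trace (hom_comp c d) >> = (u ij c *m v d) 0 0.
  have [v E] := uP ij.
  exists (fun d : dhom ty X ij.2 ij.1 => v (cls (dflip (repr d)))) => c d.
  have [e ->] := hom_flip_surj d; rewrite hom_trace_flip -/(cpair _ _ _) E.
  congr ((_ *m v _) 0 0); rewrite -[LHS]cls_repr; apply/esym/cls_eq.
  apply: isomorphic_trans (dflipK_iso (repr e)); apply: relabel_iso; exact: repr_cls.
pose uu (x : arrow ty X) (p : 'I_n * 'I_n * 'I_N) : K :=
  if x is Some (existT ij c) then (u ij c 0 p.2) *+ (ij == p.1) else 0.
pose vv (p : 'I_n * 'I_n * 'I_N) (y : arrow ty X) : K :=
  if y is Some (existT (k, l) d) then (v (l, k) d p.2 0) *+ ((l, k) == p.1) else 0.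
apply: (@factors_fin _ _ _ _ uu vv) => x y.
case: (arrowP x) => [|i j c]; first by rewrite big1 // => p _; rewrite mul0r.
case: (arrowP y) => [|k l d].
  by rewrite amulx0 big1 // => p _; rewrite mulr0.
rewrite -(pair_bigA _ (fun q m => uu (arr c) (q, m) * vv (q, m) (arr d))) /=.
rewrite (bigD1 (i, j)) //= [X in _ + X]big1 ?addr0 => [|q qij]; last first.
  by rewrite big1 // => m _; rewrite eq_sym (negbTE qij) mul0r.
have [/eqP|ne] := eqVneq (l, k) (i, j); last first.
  rewrite big1 => [|m _]; last by rewrite mulr0.
  have [kj|kj] := eqVneq k j; last by rewrite amulN.
  move: kj d ne => -> d ne; rewrite amulE /chi_trace atraceN //.
  by apply: contra ne => /eqP ->.
rewrite xpair_eqE => /andP[/eqP li /eqP kj].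
move: li kj d => -> -> d; rewrite amulE /chi_trace atraceE (vP (i, j)) mxE.
by apply: eq_bigr => m _; rewrite eqxx.
Qed.

End ArrowRank.

(** * Polynomial dependence on the parameter *)

Section PolynomialFamily.
Variables (K : closedFieldType) (K_char0 : [pchar K] =i pred0).
Variables (r : nat) (ty : 'I_r -> nat * nat).
Variables (chi : K -> character ty K) (chi_family : one_parameter_family chi).
Variables (s : nat -> K) (s_inj : injective s).
Hypothesis s_good : forall i, good (chi (s i)).
Hypothesis s_bound : forall p q, exists n, forall i,
  exists2 m, (m <= n)%N & quotient_dim (@con_rad r ty K (chi (s i)) p q) m.

Lemma quotient_dim_ext (V : lmodType K) (W W' : V -> Prop) n :
  (forall v, W v <-> W' v) -> quotient_dim W n -> quotient_dim W' n.
Proof.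
move=> E [e [H1 H2]]; exists e; split=> [v|c Wc]; last by apply: H2; apply/E.
by have [c Hc] := H1 v; exists c; apply/E.
Qed.

Lemma cpair_factors p q : exists n, forall i, factors (@cpair r ty K (chi (s i)) p q) n.
Proof.
have [n Hn] := s_bound p q; exists n => i; have [m mn Hm] := Hn i.
apply: (factors_widen mn); apply: factors_of_quotient_dim.
exact: quotient_dim_ext (fun f => con_radE (chi (s i)) f) Hm.
Qed.

Lemma value_poly (c : dclass ty 'I_0 'I_0) :
  exists p : {poly K}, forall t, chi t << c >> = p.[t].
Proof.
have [p Hp] := chi_family (repr c); exists p => t.
by rewrite -Hp /value cls_repr.
Qed.

(** Gram determinants of size above [J] are polynomials in t vanishing at all s_i, hence
    identically; this bounds the rank at every t. *)
Lemma finite_codim t p q : exists n, quotient_dim (@con_rad r ty K (chi t) p q) n.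
Proof.
have [J HJ] := cpair_factors p q.
have /choice[b bE] : forall c : dclass ty 'I_p 'I_q,
    exists b : dclass ty 'I_q 'I_p -> {poly K}, forall d t, cpair (chi t) c d = (b d).[t].
  move=> c; suff /choice[b bE] : forall d : dclass ty 'I_q 'I_p, exists b : {poly K},
      forall t, cpair (chi t) c d = b.[t] by exists b.
  by move=> d; exact: value_poly.
have G t' n f e : \det (gram (@cpair _ _ _ (chi t') p q) f e) =
    (\det (@gram _ _ _ b n f e)).[t'].
  rewrite -[RHS]/(horner_eval t' _) -det_map_mx; congr (\det _).
  by apply/matrixP=> i j; rewrite !mxE bE.
have [d [f [e [G0 Gmax]]]] : exists d (f : 'I_d -> dclass ty 'I_p 'I_q) e,
    \det (gram (@cpair _ _ _ (chi t) p q) f e) != 0 /\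
    forall f' e', \det (@gram _ _ _ (@cpair _ _ _ (chi t) p q) (d + 1) f' e') = 0.
  apply: (exists_maximal_gram (J := J)); first exact: oner_neq0.
  move=> n f e Jn; rewrite G; suff -> : \det (gram b f e) = 0 by rewrite horner0.
  apply: (poly_infinite_roots s_inj) => i; rewrite -G.
  exact: gram_det_eq0 (HJ i) Jn.
have : factors (@cpair _ _ _ (chi t) p q) d.
  by eexists; eexists => x y; exact: (maximal_gram_factors G0 Gmax).
case/quotient_dim_of_factors => m Hm; exists m.
apply: quotient_dim_ext Hm => g; split=> /con_radE //.
Qed.

Lemma family_generically_traceable (B : cuniv) :
  exists2 D : {poly K}, D != 0 & forall t, D.[t] != 0 ->
    traceable (@amul r ty _ (summand (c := B))) None (@chi_trace r ty K B (chi t)).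
Proof.
pose X := summand (c := B).
have /choice[p pE] : forall x : arrow ty X, exists p : {poly K},
    forall t, chi_trace (chi t) x = p.[t].
  move=> x; case: (arrowP x) => [|i j c]; first by exists 0 => t; rewrite horner0.
  have [ji|ji] := eqVneq j i; last by exists 0 => t; rewrite horner0 /chi_trace atraceN.
  move: ji c => -> c; have [p Hp] := value_poly (hom_trace c).
  by exists p => t; rewrite -Hp /chi_trace atraceE.
have /fin_all_exists[N NP] (ij : 'I_(n_summands B) * 'I_(n_summands B)) :=
  cpair_factors ((X ij.1).1 + (X ij.2).2) ((X ij.1).2 + (X ij.2).1).
pose M := \max_ij N ij.
have gt := @generically_traceable K _ (@amul r ty _ X) None (@amulA r ty _ X)
  (@amul0x r ty _ X) (@amulx0 r ty _ X) K_char0 (fun t => @chi_trace r ty K B (chi t))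
  p [seq arr (hom_id ty X i) | i <- enum 'I_(n_summands B)] s
  #|{: 'I_(n_summands B) * 'I_(n_summands B) * 'I_M}|.
apply: gt => //.
- by move=> t x y; exact: atraceC.
- by move=> t x; exact: atrace1.
- move=> i; apply: arrow_factors => j k.
  apply: factors_widen (NP (j, k) i); exact: leq_bigmax.
- by move=> i; apply: kills_nilpotents_of_good; exact: (s_good i).2.
Qed.

End PolynomialFamily.

Local Open Scope classical_set_scope.
Local Open Scope ring_scope.

(** * The character that counts colourings *)

Section ColourCharacter.
Variables (r : nat) (ty : 'I_r -> nat * nat) (K : closedFieldType).
Variables (n : nat) (X : 'I_n -> nat * nat) (Q : finType).

Definition no_colour (i : 'I_0) : Q := match notF (ltn_ord i) with end.

Definition count_closed (c : dclass ty 'I_0 'I_0) : K :=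
  (count_col (repr c) no_colour no_colour)%:R.

Lemma count_closedE B (D : diagram ty B 'I_0 'I_0) y x :
  count_closed (cls D) = (count_col (Q := Q) D y x)%:R.
Proof.
rewrite /count_closed (count_col_iso _ _ (repr_cls D)); congr _%:R.
by apply: eq_count_col; case.
Qed.

(** Indexes a basis of W^{a,b} for W = K^Q. *)
Definition end_col i : finType :=
  ({ffun 'I_(X i).1 -> Q} * {ffun 'I_(X i).2 -> Q})%type.

Definition colouring : finType := {i : 'I_n & end_col i}.

Definition colouring_at i (z : end_col i) : 'I_#|colouring| :=
  enum_rank (Tagged end_col z).

Lemma colouring_at_eq i z w : (@colouring_at i z == @colouring_at i w) = (z == w).
Proof. by rewrite (inj_eq enum_rank_inj) eq_Tagged. Qed.

Lemma colouring_at_neq i j z w : i != j -> (@colouring_at i z == @colouring_at j w) = false.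
Proof.
move=> ij; rewrite (inj_eq enum_rank_inj); apply/eqP=> /(congr1 tag) /= E.
by rewrite E eqxx in ij.
Qed.

Definition colour_entry i j (c : dhom ty X i j) (z : end_col i) (w : end_col j) : K :=
  (count_col (Q := Q) (repr c) (glue z.1 w.2) (glue z.2 w.1))%:R.

Definition colour_mx (x : arrow ty X) : 'M[K]_#|colouring| :=
  match x with
  | Some (existT (i, j) c) => \sum_(z : end_col i) \sum_(w : end_col j)
      @colour_entry i j c z w *: delta_mx (@colouring_at i z) (@colouring_at j w)
  | None => 0
  end.

Lemma colour_entry_comp i j k (c : dhom ty X i j) (d : dhom ty X j k) z v :
  colour_entry (hom_comp c d) z v = \sum_w colour_entry c z w * colour_entry d w v.
Proof.
rewrite /colour_entry (count_col_iso _ _ (repr_cls _)) count_col_dmixed_comp.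
by rewrite pair_big /= natr_sum; apply: eq_bigr => w _; rewrite natrM.
Qed.

Lemma colour_mxM : multiplicative_mx (@amul r ty n X) None colour_mx.
Proof.
split=> // x y; case: (arrowP x) => [|i j c]; first by rewrite mul0mx.
case: (arrowP y) => [|k l d]; first by rewrite amulx0 mulmx0.
rewrite [colour_mx (arr c)]/= [colour_mx (arr d)]/= mulmx_suml.
have [kj|kj] := eqVneq k j; last first.
  rewrite amulN // big1 // => z _; rewrite mulmx_suml big1 // => w _.
  rewrite mulmx_sumr big1 // => w' _; rewrite mulmx_sumr big1 // => v _.
  rewrite -scalemxAl -scalemxAr mul_delta_mx_cond colouring_at_neq 1?eq_sym //.
  by rewrite !scaler0.
move: kj d => -> d; rewrite amulE /=; apply: eq_bigr => z _.
rewrite mulmx_suml.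
under eq_bigr do rewrite colour_entry_comp scaler_suml.
rewrite exchange_big; apply: eq_bigr => w _ /=.
rewrite mulmx_sumr [RHS](bigD1 w) //= [X in _ + X]big1 ?addr0 => [|w' ww'].
  rewrite mulmx_sumr; apply: eq_bigr => v _.
  by rewrite -scalemxAl -scalemxAr mul_delta_mx scalerA.
rewrite mulmx_sumr big1 // => v _.
rewrite -scalemxAl -scalemxAr mul_delta_mx_cond colouring_at_eq eq_sym.
by rewrite (negbTE ww') !scaler0.
Qed.

Lemma mxtrace_delta m (i j : 'I_m) : \tr (delta_mx i j : 'M[K]_m) = (i == j)%:R.
Proof.
rewrite /mxtrace (bigD1 i) //= big1 ?addr0 => [|k ki]; rewrite mxE ?eqxx //.
by rewrite (negbTE ki).
Qed.

(** Colour counts are matrix entries of a functor, and closing up is the ordinary trace, so [H] is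
    the identity. *)
Lemma colour_traceable :
  traceable (@amul r ty n X) None (atrace (count_closed : _ -> K^o)).
Proof.
apply: (@traceableI _ _ _ _ _ colour_mx 1%:M) => [|x|x]; first exact: colour_mxM.
  by rewrite mul1mx mulmx1.
rewrite mul1mx; case: (arrowP x) => [|i j c]; first by rewrite raddf0.
have trE : \tr (colour_mx (arr c)) =
    \sum_z \sum_w colour_entry c z w * (colouring_at z == colouring_at w)%:R.
  rewrite raddf_sum; apply: eq_bigr => z _ /=; rewrite raddf_sum.
  by apply: eq_bigr => w _ /=; rewrite mxtraceZ mxtrace_delta.
rewrite trE; have [ji|ji] := eqVneq j i; last first.
  rewrite atraceN // big1 // => z _; rewrite big1 // => w _.
  by rewrite colouring_at_neq 1?eq_sym // mulr0.
move: ji c {trE} => -> c; rewrite atraceE (count_closedE _ no_colour no_colour).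
rewrite count_col_dmixed_trace pair_big /= natr_sum; apply: eq_bigr => z _.
rewrite (bigD1 z) //= eqxx mulr1 big1 ?addr0 // => w wz.
by rewrite colouring_at_eq eq_sym (negbTE wz) mulr0.
Qed.

End ColourCharacter.

(** * From connected to arbitrary closed diagrams *)

Section ClosedDiagrams.
Variables (r : nat) (ty : 'I_r -> nat * nat) (K : closedFieldType).
Variables (chi : K -> character ty K).

Lemma value_iso (ch : character ty K) (B B' : finType) (D : diagram ty B 'I_0 'I_0)
    (D' : diagram ty B' 'I_0 'I_0) : isomorphic D D' -> value ch D = value ch D'.
Proof. by move=> H; congr (ch << _ >>); apply/cls_eq. Qed.

Lemma value_one (ch : character ty K) : value ch (didentity ty 'I_0) = 1.
Proof. exact: (rmorph1 ch). Qed.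

Lemma value_djuxt (ch : character ty K) (B1 B2 : finType)
    (D1 : diagram ty B1 'I_0 'I_0) (D2 : diagram ty B2 'I_0 'I_0) :
  value ch (djuxt D1 D2) = value ch D1 * value ch D2.
Proof.
rewrite /value -[RHS](rmorphM ch); congr (ch _).
rewrite malgM_def fgmulUU mulr1; congr << _ >>; apply/cls_eq/isomorphic_sym.
by apply: djuxt_iso; exact: repr_cls.
Qed.

(** Both sides are multiplicative under juxtaposition, and on a connected diagram the count is
    [q]. *)
Lemma additive_family_mulrn (t : K) (q : nat) (c : dclass ty 'I_0 'I_0) :
  additive_family chi ->
  chi (t *+ q) << c >> = chi t << c >> * count_closed K 'I_q c.
Proof.
move=> add.
have y0 : 'I_0 -> 'I_q by case.
suff H B (D : diagram ty B 'I_0 'I_0) :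
    value (chi (t *+ q)) D = value (chi t) D * (count_col (Q := 'I_q) D y0 y0)%:R.
  by have := H _ (repr c); rewrite /value -(count_closedE _ _ y0 y0) cls_repr.
elim/closed_diagram_ind: D => {B} [B B' D D' iso||B|B1 B2 D1 D2 H1 H2].
- by rewrite (value_iso _ iso) (value_iso _ iso) (count_col_iso _ _ iso).
- by rewrite !value_one count_col_no_box ?card_void //= mul1r.
- move=> D conn; rewrite count_col_connected // card_ord mulr_natr.
  elim: q {y0} => [|q IH]; last by rewrite mulrS -add // IH mulrS.
  (* For [q] = 0: additivity at 0 + 0 makes the value 0. *)
  have := add 0 0 B D conn; rewrite addr0 => /eqP.
  by rewrite -subr_eq0 addrK mulr0n => /eqP.
- by rewrite !value_djuxt H1 H2 count_col_djuxt natrM mulrACA.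
Qed.

Lemma multiplicative_familyM (t1 t2 : K) (c : dclass ty 'I_0 'I_0) :
  multiplicative_family chi ->
  chi (t1 * t2) << c >> = chi t1 << c >> * chi t2 << c >>.
Proof.
move=> mult.
suff H B (D : diagram ty B 'I_0 'I_0) :
    value (chi (t1 * t2)) D = value (chi t1) D * value (chi t2) D.
  by have := H _ (repr c); rewrite /value cls_repr.
elim/closed_diagram_ind: D => {B} [B B' D D' iso||B D conn|B1 B2 D1 D2 H1 H2].
- by rewrite !(value_iso _ iso).
- by rewrite !value_one mulr1.
- by rewrite mult.
- by rewrite !value_djuxt H1 H2 mulrACA.
Qed.

Lemma traceable_of_mul (B : cuniv) (ch : character ty K) (w1 w2 : dclass ty 'I_0 'I_0 -> K^o) :
  (forall c, ch << c >> = w1 c * w2 c) ->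
  traceable (@amul r ty _ (summand (c := B))) None (atrace w1) ->
  traceable (@amul r ty _ (summand (c := B))) None (atrace w2) ->
  traceable (@amul r ty _ (summand (c := B))) None (@chi_trace r ty K B ch).
Proof.
move=> E H1 H2; have := traceable_mul H1 H2; congr (traceable _ _ _); apply/funext=> x.
case: (arrowP x) => [|i j c]; first by rewrite mulr0.
have [ji|ji] := eqVneq j i; last by rewrite /chi_trace !atraceN // mulr0.
by move: ji c => -> c; rewrite /chi_trace !atraceE E.
Qed.

End ClosedDiagrams.

(** * Countability of the objects and conclusion *)

Lemma cuniv_countable : exists E : nat -> cuniv, forall B, exists i, B = E i.
Proof.
pose T := {n : nat & n.-tuple (nat * nat)}.
(* Objects are coded by tuples; numbers that code none go to the zero object. *)
exists (fun i => if (choice.unpickle i : option T) is Some (existT n l) then Cuniv (tnth l)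
                 else Cuniv (tnth [tuple])).
case=> n f; exists (choice.pickle
  (existT (fun n => n.-tuple (nat * nat)) n [tuple f i | i < n] : T)).
rewrite choice.pickleK; congr Cuniv; apply/funext=> i.
by rewrite tnth_mktuple.
Qed.

Theorem proposition7p7 (K : closedFieldType) (K_char0 : [pchar K] =i pred0)
    (r : nat) (ty : 'I_r -> nat * nat)
    (chi : K -> character ty K) (chi_family : one_parameter_family chi)
    (s : nat -> K) (s_inj : injective s)
    (s_good : forall i, good (chi (s i)))
    (s_bound : forall p q, exists n, forall i,
       exists2 m, (m <= n)%N & quotient_dim (@con_rad r ty K (chi (s i)) p q) m) :
  [/\ countable [set t | ~ good (chi t)],
      additive_family chi -> forall t, good (chi t)
    & multiplicative_family chi -> forall t, t != 0 -> good (chi t)].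
Proof.
have fc := finite_codim chi_family s_inj s_bound.
have gt := family_generically_traceable K_char0 chi_family s_inj s_good s_bound.
pose tr (B : cuniv) t :=
  traceable (@amul r ty _ (summand (c := B))) None (@chi_trace r ty K B (chi t)).
have goodI t : (forall B, tr B t) -> good (chi t).
  move=> trt; split=> [p q|B T m m0 neg]; first exact: fc.
  exact: (kills_trace_of_traceable (trt B)) m0 neg.
have natK (m : nat) : (m%:R == 0 :> K) = (m == 0)%N.
  by have/pcharf0P-> := K_char0.
have nonroot (D : {poly K}) (f : nat -> K) : D != 0 -> injective f ->
    exists i, D.[f i] != 0.
  move=> D0 f_inj; apply: contrapT => N; move/eqP: D0; apply.
  apply: (poly_infinite_roots f_inj) => i; apply/eqP/negPn/negP=> Di.
  by apply: N; exists i.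
split.
- have [E EP] := cuniv_countable.
  have /choice[D DP] : forall i, exists D : {poly K},
      D != 0 /\ forall t, D.[t] != 0 -> tr (E i) t.
    by move=> i; have [D D0 HD] := gt (E i); exists D.
  (* If chi_t is not good, traceability fails for some object [E i], so t is a root of [D i]. *)
  apply: (@sub_countable _ _ _ (\bigcup_i [set t | root (D i) t])).
    apply: subset_card_le => t; apply: contra_notP => nt; apply: goodI => B.
    have [i ->] := EP B; apply: (DP i).2; apply/negP=> Dt; apply: nt.
    by exists i.
  apply: bigcup_countable => // i _; apply: finite_set_countable.
  have [rs Drs] := closed_field_poly_normal (D i).
  apply: (sub_finite_set _ (finite_seq rs)) => t /=.
  rewrite Drs rootZ ?lead_coef_eq0; last exact: (DP i).1.
  by rewrite root_prod_XsubC.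
- move=> add t; apply: goodI => B; have [D D0 HD] := gt B.
  (* At 0 all quotients t / q coincide; instead chi_0 is chi_(s_i) times the count of colourings by
     the empty set. *)
  have [-> | t0] := eqVneq t 0.
    have [i Di] := nonroot D s D0 s_inj.
    have W := @traceable_of_mul r ty K B (chi 0) (fun c => chi (s i) << c >>)
      (count_closed K 'I_0) _ (HD _ Di) (@colour_traceable r ty K _ _ 'I_0).
    apply: W => c.
    by rewrite -additive_family_mulrn // mulr0n.
  (* In characteristic zero the points t / (i+1) are distinct, so one of them is not a root of
     [D]. *)
  have [i Di] : exists i : nat, D.[t / i.+1%:R] != 0.
    apply: nonroot => // i j /(mulfI t0)/invr_inj/eqP.
    wlog ij : i j / (i <= j)%N => [W|].
      case/orP: (leq_total i j) => le; first exact: W.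
      by rewrite eq_sym => ji; apply/esym/W.
    rewrite eq_sym -subr_eq0 -natrB // natK subSS subn_eq0 => ji.
    by apply/eqP; rewrite eqn_leq ij.
  have W := @traceable_of_mul r ty K B (chi t) (fun c => chi (t / i.+1%:R) << c >>)
    (count_closed K 'I_i.+1) _ (HD _ Di) (@colour_traceable r ty K _ _ 'I_i.+1).
  apply: W => c.
  by rewrite -additive_family_mulrn // -[_ / _ *+ _]mulr_natr divfK // natK.
- move=> mult t t0; apply: goodI => B; have [D D0 HD] := gt B.
  have [rs Drs] := closed_field_poly_normal D.
  (* Vanishes at each nonzero u for which t / u is a root of [D]; its value at 0 is nonzero because
     t is. *)
  pose D2 := \prod_(z <- rs) (z *: 'X - t%:P).
  have D20 : D2 != 0.
    rewrite /D2 prodf_seq_neq0; apply/allP=> z _ /=; apply/eqP=> /(congr1 (horner^~ 0))/eqP.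
    by rewrite !hornerE ?mulr0 ?sub0r oppr_eq0 (negbTE t0).
  (* The factor X forces the chosen s_i to be nonzero. *)
  have D3 := mulf_neq0 (mulf_neq0 D0 D20) (negbT (polyX_eq0 K)).
  have [i] := nonroot _ s D3 s_inj.
  rewrite !hornerM hornerX !mulf_eq0 !negb_or => /andP[/andP[Di D2i] si0].
  have Dti : D.[t / s i] != 0.
    apply: contra D2i; rewrite -[_ == 0]/(root D _) Drs rootZ ?lead_coef_eq0 //.
    rewrite root_prod_XsubC => zs; rewrite /D2 horner_prod prodf_seq_eq0.
    apply/hasP; exists (t / s i) => //=.
    by rewrite !hornerE divfK // subrr.
  have W := @traceable_of_mul r ty K B (chi t) (fun c => chi (s i) << c >>)
    (fun c => chi (t / s i) << c >>) _ (HD _ Di) (HD _ Dti).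
  apply: W => c.
  by rewrite -multiplicative_familyM // mulrC divfK.
Qed.
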